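(* Suppose that $f=h+\overline{g}\in\mathcal{H}$, where $h(z)=\sum_{n=1}^{\infty}a_nz^n$ with $a_1=1$ and $g(z)=\sum_{n=1}^{\infty}b_nz^n$ are analytic in $\mathbb{D}$, satisfies the condition $$\sum_{n=1}^{\infty}|(n+1)a_{n+1}-(n-1)a_{n-1}|+\sum_{n=1}^{\infty}|(n+1)b_{n+1}-(n-1)b_{n-1}|\leq 1-|b_1|.$$ Then $f\in\mathcal{F}_2$. In particular, $f$ is convex in the vertical direction in $\mathbb{D}$ and hence close-to-convex in $\mathbb{D}$.
   Context: $\mathbb{D}=\{z\in\mathbb{C}:|z|<1\}$. $\mathcal{H}$ is the class of complex-valued harmonic functions $f$ in $\mathbb{D}$ with $f(0)=0=f_z(0)-1$; each such $f$ is written canonically as $f=h+\overline{g}$ with $h,g$ analytic in $\mathbb{D}$, $h(z)=z+\sum_{n\ge2}a_nz^n$, $g(z)=\sum_{n\ge1}b_nz^n$ (so $f_z=h'$ and $|f_{\overline z}|=|g'|$). The series for $h$ and $g$ have no constant terms, i.e. $a_0=b_0=0$, so in the sums the terms $(n-1)a_{n-1}$ and $(n-1)b_{n-1}$ vanish for $n=1$. $\mathcal{F}_2=\{f\in\mathcal{H}: \mathrm{Re}\{(1-z^2)f_z(z)\}>|(1-z^2)f_{\overline z}(z)| \text{ for all } z\in\mathbb{D}\}$. A harmonic function $f$ in $\mathbb{D}$ is convex in the vertical direction if it is univalent in $\mathbb{D}$ and every line parallel to the imaginary axis has a connected (possibly empty) intersection with $f(\mathbb{D})$. It is close-to-convex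 in $\mathbb{D}$ if it is univalent in $\mathbb{D}$ and $f(\mathbb{D})$ is a close-to-convex domain, i.e. the complement of $f(\mathbb{D})$ in $\mathbb{C}$ is a union of closed half-lines that do not cross (pairwise disjoint except that the origin of one may lie on another).
   Formalization: The hypothesis |b_1| < 1 is added: the stated condition allows |b_1| = 1, where the claim always fails since F_2 at z = 0 requires 1 > |b_1| (e.g. h = g = (1/2) log((1+z)/(1-z))). *)

(* Defs.v *)
(* MathComp-Analysis, complex numbers R[i] over a realType R *)
From HB Require Import structures.
From mathcomp Require Import all_boot all_order all_algebra.
From mathcomp Require Import complex.
From mathcomp Require Import all_classical all_reals all_analysis.

Set Implicit Arguments.
Unset Strict Implicit.
Unset Printing Implicit Defensive.

Import Order.TTheory GRing.Theory Num.Theory.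
Import numFieldNormedType.Exports.
Local Open Scope classical_set_scope.
Local Open Scope ring_scope.
Local Open Scope complex_scope.

(* R[i] gets the topology and norm that the library puts on any numeric field
   (seen as a normed module over itself).  The norm `|z| lives in R[i]; the
   R-valued modulus is Normc.normc z, with `|z| = (Normc.normc z)%:C. *)
HB.instance Definition _ (R : rcfType) := NormedModule.copy R[i] R[i]^o.

Notation normc := Normc.normc.

Section Definitions.
Variable R : realType.
Implicit Types (f : R[i] -> R[i]) (u : R[i] -> R) (z w : R[i]) (A : set R[i]).

Definition unit_disk : set R[i] := [set z | normc z < 1].

(* Complex differentiability: derivable is taken over the scalar field R[i]. *)
Definition analytic_on A f := forall z, A z -> derivable f z 1.

Definition dx u z : R :=
  derive1 (fun t : R => u (t +i* complex.Im z)) (complex.Re z).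
Definition dy u z : R :=
  derive1 (fun t : R => u (complex.Re z +i* t)) (complex.Im z).

Definition C1_on A u := forall z, A z ->
  [/\ derivable (fun t : R => u (t +i* complex.Im z)) (complex.Re z) 1,
      derivable (fun t : R => u (complex.Re z +i* t)) (complex.Im z) 1,
      {for z, continuous (dx u)} &
      {for z, continuous (dy u)}].

Definition C2_on A u := [/\ C1_on A u, C1_on A (dx u) & C1_on A (dy u)].

Definition harmonic_on A u :=
  C2_on A u /\ forall z, A z -> dx (dx u) z + dy (dy u) z = 0.

Definition re_part f : R[i] -> R := fun z => complex.Re (f z).
Definition im_part f : R[i] -> R := fun z => complex.Im (f z).

Definition complex_harmonic_on A f :=
  harmonic_on A (re_part f) /\ harmonic_on A (im_part f).

Definition f_x f z : R[i] := dx (re_part f) z +i* dx (im_part f) z.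
Definition f_y f z : R[i] := dy (re_part f) z +i* dy (im_part f) z.

Definition f_z f z : R[i] := (f_x f z - 'i * f_y f z) / 2%:R.
Definition f_zbar f z : R[i] := (f_x f z + 'i * f_y f z) / 2%:R.

Definition class_H f :=
  [/\ complex_harmonic_on unit_disk f, f 0 = 0 & f_z f 0 = 1].

Definition class_F2 f := class_H f /\
  forall z, unit_disk z ->
    complex.Re ((1 - z ^+ 2) * f_z f z) > normc ((1 - z ^+ 2) * f_zbar f z).

Definition univalent f := {in unit_disk &, injective f}.

Definition vertical_line (c : R) : set R[i] := [set w | complex.Re w = c].

(* The empty set is connected for the library. *)
Definition convex_in_vertical_direction f := univalent f /\
  forall c : R, connected (vertical_line c `&` f @` unit_disk).

Definition half_line (o d : R[i]) : set R[i] :=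
  [set w | exists2 t : R, 0 <= t & w = o + t%:C * d].

(* A family of closed half-lines is given by a set L of pairs
   (origin, unit direction), so that distinct pairs are distinct half-lines.
   Two distinct half-lines may only meet at a point that is the origin of one of
   them; their intersection being convex, it then has at most one point. *)
Definition close_to_convex_domain A :=
  [/\ open A, connected A &
    exists L : set (R[i] * R[i]),
      [/\ forall l, L l -> normc l.2 = 1,
          ~` A = \bigcup_(l in L) half_line l.1 l.2 &
          forall l l', L l -> L l' -> l <> l' ->
            half_line l.1 l.2 `&` half_line l'.1 l'.2 `<=` [set l.1; l'.1]]].

Definition close_to_convex f :=
  univalent f /\ close_to_convex_domain (f @` unit_disk).

End Definitions.

Arguments unit_disk {R}.

(* Main.v *)
Require Import Defs.
From HB Require Import structures.
From mathcomp Require Import all_boot all_order all_algebra.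
From mathcomp Require Import complex.
From mathcomp Require Import all_classical all_reals all_analysis.
From mathcomp Require Import ring lra.
Set Implicit Arguments.
Unset Strict Implicit.
Unset Printing Implicit Defensive.

Import Order.TTheory GRing.Theory Num.Theory.
Import numFieldNormedType.Exports.
Local Open Scope classical_set_scope.
Local Open Scope ring_scope.
Local Open Scope complex_scope.

(** The map z = tanh w sends the strip |Im w| < pi / 4 onto the unit disk, and
    dz / dw = 1 - z ^ 2.  Read in the strip, f becomes F(w) = H(w) + conj G(w),
    with H' = P := (1 - z^2) h' and G' = Q := (1 - z^2) g', and the inequality
    that defines the class is just |Q| < Re P.

    The inequality comes from the coefficients.  The Taylor coefficients of
    (1 - z^2) h' are (n+1) a_(n+1) - (n-1) a_(n-1), with constant term a_1 = 1,
    and likewise for g, so for |z| < 1 the bound on the two sums gives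
    |P - 1| + |Q| <= |b_1| + |z| (1 - |b_1|) < 1
    ([weighted_series_cvg], [weighted_dominated]).

    The geometry comes from the inequality.  Along a segment w + s d of the
    strip, the derivative of Re (conj d * F) is Re (|d|^2 P + conj (d^2 Q)) > 0,
    so F is strictly monotone as a vector field of the plane
    ([strip_monotone]).  Hence f is univalent, Phi = Re F is increasing along
    horizontal lines, and each level set Phi = c is a graph u = phi_c(v) along
    which Psi = Im F is increasing.  The intermediate value theorem then shows
    that the part of the image on the line Re = c is an interval and that the
    image is open, as soon as the set of the heights v at which Phi takes the
    value c is an interval.

    That last point is [strip_level_convex].  The series of P + Q converges
    absolutely on the closed disk, so P + Q is uniformly continuous on the disk;
    and tanh (u + i v) tends to 1 or to -1, uniformly in v, as u tends to
    +oo or to -oo.  So for large |u| the vertical derivative of Phi is nearly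
    independent of v, that is, Phi is nearly affine in v.  If Phi takes the value
    c at the heights v1 and v2, then Phi > c at both heights for large u, hence
    also at every height in between; symmetrically Phi < c for u near -oo; so
    the value c is taken in between.

    Finally, an open connected set that meets every vertical line in an interval
    is close-to-convex: its complement is the union of the vertical half-lines
    above and below these intervals, and two opposite half-lines for a line that
    the set misses ([vertically_convex_close_to_convex]). *)

(** * Topology of the complex plane and first-order expansions *)

Section ComplexTopology.
Variable R : realType.
Implicit Types (z w : R[i]) (x y e : R).

Lemma normr_normc z : `|z| = (normc z)%:C.
Proof. by []. Qed.

Lemma normc_ge0 z : 0 <= normc z.
Proof. by rewrite -ler0c -normr_normc. Qed.

Lemma ler_normcD z w : normc (z + w) <= normc z + normc w.
Proof. exact: le_normcD. Qed.

Lemma normc_opp z : normc (- z) = normc z.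
Proof. exact: normcN. Qed.

Lemma normcB z w : normc (z - w) = normc (w - z).
Proof. by rewrite -opprB normc_opp. Qed.

Lemma conjcD z w : conjc (z + w) = conjc z + conjc w.
Proof. exact: rmorphD. Qed.

Lemma conjcM z w : conjc (z * w) = conjc z * conjc w.
Proof. exact: rmorphM. Qed.

Lemma normc_conj z : normc (conjc z) = normc z.
Proof. by case: z => x y /=; rewrite sqrrN. Qed.

Lemma normc_real x : normc x%:C = `|x|.
Proof. by rewrite /= expr0n addr0 sqrtr_sqr. Qed.

Lemma normcX z n : normc (z ^+ n) = normc z ^+ n.
Proof.
elim: n => [|n IHn]; first by rewrite !expr0 Normc.normc1.
by rewrite !exprS Normc.normcM IHn.
Qed.

Lemma normc_nat n : normc (n%:R : R[i]) = n%:R.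
Proof. by have := normcMn (1 : R[i]) n; rewrite Normc.normc1. Qed.

Lemma sqr_normcE z : normc z ^+ 2 = complex.Re z ^+ 2 + complex.Im z ^+ 2.
Proof. by case: z => x y /=; rewrite sqr_sqrtr // addr_ge0 ?sqr_ge0. Qed.

Lemma Re_le_normc z : `|complex.Re z| <= normc z.
Proof.
case: z => x y /=; rewrite -sqrtr_sqr ler_wsqrtr//.
by rewrite lerDl sqr_ge0.
Qed.

Lemma Im_le_normc z : `|complex.Im z| <= normc z.
Proof.
case: z => x y /=; rewrite -sqrtr_sqr ler_wsqrtr//.
by rewrite lerDr sqr_ge0.
Qed.

Lemma normc_leD z : normc z <= `|complex.Re z| + `|complex.Im z|.
Proof.
case: z => x y /=; rewrite -[leRHS]ger0_norm ?addr_ge0// -sqrtr_sqr ler_wsqrtr//.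
by rewrite sqrrD !real_normK ?num_real// addrAC lerDl mulrn_wge0// mulr_ge0.
Qed.

Lemma ReB z w : complex.Re (z - w) = complex.Re z - complex.Re w.
Proof. by case: z w => [? ?] [? ?]. Qed.

Lemma ImB z w : complex.Im (z - w) = complex.Im z - complex.Im w.
Proof. by case: z w => [? ?] [? ?]. Qed.

(** The norm that defines the topology takes its values in R[i] itself;
    neighborhoods are rephrased here with the real-valued modulus. *)
Lemma nbhs_normcP z (A : set R[i]) :
  nbhs z A <-> exists2 e : R, 0 < e & forall w, normc (w - z) < e -> A w.
Proof.
split.
  move=> /nbhs_ballP[e /= e0 eA]; have := e0; rewrite ltcE /= => /andP[/eqP Ie Re0].
  exists (complex.Re e) => // w wz; apply: eA.
  rewrite -ball_normE /ball_/= normr_normc normcB ltcE /= Ie eqxx /=.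
  exact: wz.
move=> [e e0 eA]; apply/nbhs_ballP; exists e%:C; first by rewrite /= ltcR.
move=> w; by rewrite -ball_normE /ball_/= normr_normc normcB ltcR => /eA.
Qed.

Lemma cvgC_normcP (T : Type) (F : set_system T) {FF : Filter F}
    (f : T -> R[i]) (l : R[i]) :
  f @ F --> l <-> forall e : R, 0 < e -> \forall t \near F, normc (f t - l) < e.
Proof.
split.
  move=> fl e e0; apply: (fl [set w | normc (w - l) < e]); apply/nbhs_normcP.
  by exists e.
move=> H A /nbhs_normcP[e e0 eA]; have := H _ e0.
by apply: filterS => t; exact: eA.
Qed.

Lemma near_normc z e : 0 < e -> \forall w \near z, normc (w - z) < e.
Proof. by move=> e0; apply/nbhs_normcP; exists e. Qed.

Lemma Re_continuous : continuous (@complex.Re R).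
Proof.
move=> z; apply/(cvgrPdist_lt (FF := nbhs_filter z)) => e e0; near=> w.
rewrite -ReB (le_lt_trans (Re_le_normc _))// normcB; near: w.
exact: near_normc.
Unshelve. all: by end_near. Qed.

Lemma Im_continuous : continuous (@complex.Im R).
Proof.
move=> z; apply/(cvgrPdist_lt (FF := nbhs_filter z)) => e e0; near=> w.
rewrite -ImB (le_lt_trans (Im_le_normc _))// normcB; near: w.
exact: near_normc.
Unshelve. all: by end_near. Qed.

Lemma cvg_complex (T : Type) (F : set_system T) {FF : Filter F}
    (f g : T -> R) (x y : R) :
  f @ F --> x -> g @ F --> y -> (fun i : T => f i +i* g i) @ F --> x +i* y.
Proof.
move=> fx gy; apply/cvgC_normcP => e e0; near=> t.
rewrite (le_lt_trans (normc_leD _))//= [ltRHS]splitr ltrD// distrC; near: t.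
  by move/cvgrPdist_lt : fx; apply; lra.
by move/cvgrPdist_lt : gy; apply; lra.
Unshelve. all: by end_near. Qed.

Lemma cvgC_mull (T : Type) (F : set_system T) {FF : Filter F} (f : T -> R[i]) (a l : R[i]) :
  f @ F --> l -> (fun t => a * f t) @ F --> a * l.
Proof.
move=> /cvgC_normcP fl; apply/cvgC_normcP => e e0.
have a0 : 0 < 1 + normc a by rewrite ltr_pwDl// normc_ge0.
have := fl _ (divr_gt0 e0 a0); apply: filterS => t; rewrite ltr_pdivlMr//.
rewrite -mulrBr Normc.normcM; apply: le_lt_trans.
by rewrite mulrC ler_wpM2l ?normc_ge0// lerDr.
Qed.

Lemma cvgC_B (T : Type) (F : set_system T) {FF : Filter F} (f g : T -> R[i]) (a b : R[i]) :
  f @ F --> a -> g @ F --> b -> (fun t => f t - g t) @ F --> a - b.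
Proof.
move=> /cvgC_normcP fa /cvgC_normcP gb; apply/cvgC_normcP => e e0.
have e2 : 0 < e / 2 by rewrite divr_gt0.
apply: filterS2 (fa _ e2) (gb _ e2) => t h1 h2.
rewrite (_ : _ - _ = (f t - a) - (g t - b)); last by ring.
by rewrite (le_lt_trans (ler_normcD _ _))// normc_opp (splitr e) ltrD.
Qed.
Lemma cvgC_shiftS (u : nat -> R[i]) (l : R[i]) :
  u @ \oo --> l -> (fun n => u n.+1) @ \oo --> l.
Proof.
move=> /cvgC_normcP ul; apply/cvgC_normcP => e /ul [N _ hN].
by exists N => // n /= Nn; apply: hN => /=; exact: leqW.
Qed.

(** Used twice to reach the partial sums of index n + 2, where the telescoping
    of the weighted coefficients is visible. *)
Lemma cvgC_unshiftS (u : nat -> R[i]) (l : R[i]) :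
  (fun n => u n.+1) @ \oo --> l -> u @ \oo --> l.
Proof.
move=> /cvgC_normcP ul; apply/cvgC_normcP => e /ul [N _ hN].
by exists N.+1 => // -[//|n] /= Nn; apply: hN.
Qed.

Lemma open_unit_disk : open (@unit_disk R).
Proof.
rewrite openE => z /= z1; apply/nbhs_normcP; exists (1 - normc z) => [|w].
  by rewrite subr_gt0.
rewrite ltrBrDr => wz; rewrite /unit_disk /=.
have -> : w = (w - z) + z by ring.
exact: le_lt_trans (ler_normcD _ _) wz.
Qed.

(** First-order expansion f(w) = f(z) + k (w - z) + l conj (w - z) + o(w - z):
    k and l are the Wirtinger derivatives of f at z.  The case l = 0 is complex
    differentiability. *)
Definition has_wirtinger (f : R[i] -> R[i]) z (k l : R[i]) :=
  forall e : R, 0 < e -> \forall w \near z,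
    normc (f w - f z - (k * (w - z) + l * conjc (w - z))) <= e * normc (w - z).

(** The derivative at t of a curve in R[i], in a form that composes with
    Wirtinger expansions without dividing. *)
Definition velocity (c : R -> R[i]) t (d : R[i]) :=
  forall e : R, 0 < e -> \forall s \near t,
    normc (c s - c t - (s - t)%:C * d) <= e * `|s - t|.

Lemma has_wirtinger_continuous f z k l : has_wirtinger f z k l -> {for z, continuous f}.
Proof.
move=> fz; apply/(cvgC_normcP (FF := nbhs_filter z)) => e e0.
pose K := 1 + normc k + normc l.
have K0 : 0 < K by rewrite /K -addrA ltr_pwDl// addr_ge0 ?normc_ge0.
near=> w.
have h1 : normc (f w - f z - (k * (w - z) + l * conjc (w - z))) <= 1 * normc (w - z).
  by near: w; exact: fz.
have h2 : normc (w - z) < e / K by near: w; apply: near_normc; exact: divr_gt0.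
have -> : f w - f z = (f w - f z - (k * (w - z) + l * conjc (w - z))) +
   (k * (w - z) + l * conjc (w - z)) by ring.
apply: (le_lt_trans (ler_normcD _ _)).
apply: (@le_lt_trans _ _ (K * normc (w - z))); last by rewrite mulrC -ltr_pdivlMr.
rewrite /K !mulrDl -(addrA (1 * _)) lerD//.
by rewrite (le_trans (ler_normcD _ _))// !Normc.normcM normc_conj.
Unshelve. all: by end_near. Qed.

Lemma velocity_continuous c t d : velocity c t d -> {for t, continuous c}.
Proof.
move=> ct; apply/cvgC_normcP => e e0.
pose K := 1 + normc d.
have K0 : 0 < K by rewrite /K ltr_pwDl// normc_ge0.
near=> s.
have h1 : normc (c s - c t - (s - t)%:C * d) <= 1 * `|s - t|.
  by near: s; exact: ct.
have h2 : `|s - t| < e / K.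
  near: s; have := @cvg_id _ (nbhs t); move/cvgrPdist_lt => /(_ (e / K)).
  by move=> /(_ (divr_gt0 e0 K0)); apply: filterS => s; rewrite distrC.
have -> : c s - c t = (c s - c t - (s - t)%:C * d) + (s - t)%:C * d by ring.
apply: (le_lt_trans (ler_normcD _ _)).
apply: (@le_lt_trans _ _ (K * `|s - t|)); last by rewrite mulrC -ltr_pdivlMr.
by rewrite /K mulrDl lerD// Normc.normcM normc_real mulrC.
Unshelve. all: by end_near. Qed.

Lemma velocity_comp f c t d k l :
  has_wirtinger f (c t) k l -> velocity c t d -> velocity (f \o c) t (k * d + l * conjc d).
Proof.
move=> fz ct e e0.
pose K := 1 + normc d; pose L := 1 + normc k + normc l.
have K0 : 0 < K by rewrite /K ltr_pwDl// normc_ge0.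
have L0 : 0 < L by rewrite /L -addrA ltr_pwDl// addr_ge0 ?normc_ge0.
have e1 : 0 < e / 2 / K by rewrite !divr_gt0.
have e2 : 0 < e / 2 / L by rewrite !divr_gt0.
near=> s => /=.
have h0 : normc (c s - c t - (s - t)%:C * d) <= 1 * `|s - t|.
  by near: s; exact: ct.
have h1 : normc (f (c s) - f (c t) - (k * (c s - c t) + l * conjc (c s - c t)))
    <= e / 2 / K * normc (c s - c t).
  by near: s; exact: (velocity_continuous ct (fz _ e1)).
have h2 : normc (c s - c t - (s - t)%:C * d) <= e / 2 / L * `|s - t|.
  by near: s; exact: ct.
set a := c s - c t - (s - t)%:C * d in h0 h2.
have aE : c s - c t = a + (s - t)%:C * d by rewrite /a; ring.
have -> : f (c s) - f (c t) - (s - t)%:C * (k * d + l * conjc d) =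
  (f (c s) - f (c t) - (k * (c s - c t) + l * conjc (c s - c t))) +
  (k * a + l * conjc a).
  by rewrite aE conjcD conjcM conjc_real; ring.
apply: (le_trans (ler_normcD _ _)).
have b1 : normc (c s - c t) <= K * `|s - t|.
  rewrite aE (le_trans (ler_normcD _ _))// /K mulrDl lerD//.
  by rewrite Normc.normcM normc_real mulrC.
have b2 : normc (k * a + l * conjc a) <= L * normc a.
  rewrite (le_trans (ler_normcD _ _))// !Normc.normcM normc_conj /L !mulrDl.
  by rewrite lerD2r lerDr mul1r normc_ge0.
have -> : e * `|s - t| = e / 2 / K * (K * `|s - t|) + L * (e / 2 / L * `|s - t|).
  by field; rewrite !gt_eqF.
rewrite lerD//.
  by rewrite (le_trans h1)// ler_wpM2l// ltW.
by rewrite (le_trans b2)// ler_wpM2l// ltW.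
Unshelve. all: by end_near. Qed.

(** Puts real derivatives in the same quotient-free form as [velocity]. *)
Lemma is_derive1P (u : R -> R) (t du : R) : is_derive t 1 u du <->
  forall e, 0 < e -> \forall s \near t, `|u s - u t - (s - t) * du| <= e * `|s - t|.
Proof.
split.
  move=> [du1 du2] e e0.
  have : (fun h : R => h^-1 *: (u (h *: 1 + t) - u t)) @ 0^' --> du.
    by rewrite -du2; exact: du1.
  move/cvgrPdist_lt => /(_ e e0) /nbhs_ballP[r /= r0 hr].
  apply/nbhs_ballP; exists r => // s; rewrite /ball/= distrC => st.
  have [->|sNt] := eqVneq s t; first by rewrite !subrr mul0r subr0 normr0 mulr0.
  have st0 : s - t != 0 by rewrite subr_eq0.
  have := hr (s - t); rewrite /ball/= sub0r normrN => /(_ st st0).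
  rewrite scaler1 subrK => /ltW hle.
  rewrite -[leLHS](_ : `|du - (s - t)^-1 *: (u s - u t)| * `|s - t| = _).
    by rewrite ler_wpM2r.
  rewrite -normrM -normrN; congr `| _ |; rewrite /GRing.scale/=; by field.
move=> H.
have L : (fun h : R => h^-1 *: (u (h *: 1 + t) - u t)) @ 0^' --> du.
  apply/cvgrPdist_le => e e0; have /nbhs_ballP[r /= r0 hr] := H _ e0.
  apply/nbhs_ballP; exists r => // h; rewrite /ball/= sub0r normrN => hr' h0.
  have := hr (h + t); rewrite /ball/= opprD addrCA subrr addr0 normrN => /(_ hr').
  rewrite addrK scaler1 => hle.
  rewrite -(ler_pM2r (_ : 0 < `|h|)) ?normr_gt0// (le_trans _ hle)//.
  rewrite -normrM -normrN le_eqVlt; apply/orP; left; apply/eqP; congr `| _ |.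
  by rewrite /GRing.scale/=; field.
split; first by apply/cvg_ex; exists du.
exact: cvg_lim L.
Qed.

(** The factor m selects a direction of projection: with m = conj d this is the
    derivative of the component of the curve along d. *)
Lemma velocity_Re (c : R -> R[i]) (t : R) (d m : R[i]) : velocity c t d ->
  is_derive t 1 (fun s => complex.Re (m * c s)) (complex.Re (m * d)).
Proof.
move=> ct; apply/is_derive1P => e e0.
have K0 : 0 < 1 + normc m by rewrite ltr_pwDl// normc_ge0.
have := ct _ (divr_gt0 e0 K0); apply: filterS => s hs.
rewrite (_ : _ - _ = complex.Re (m * (c s - c t - (s - t)%:C * d))); last first.
  case: (m) (c s) (c t) (d) => [m1 m2] [x1 x2] [y1 y2] [d1 d2] /=; ring.
rewrite (le_trans (Re_le_normc _))// Normc.normcM.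
rewrite (@le_trans _ _ ((1 + normc m) * (e / (1 + normc m) * `|s - t|)))//.
  rewrite ler_pM// ?normc_ge0// lerDr//.
by rewrite mulrA mulrCA mulfV ?mulr1// gt_eqF.
Qed.

Lemma velocity_complex (x y : R -> R) (t dx dy : R) :
  is_derive t 1 x dx -> is_derive t 1 y dy ->
  velocity (fun s => x s +i* y s) t (dx +i* dy).
Proof.
move=> /is_derive1P hx /is_derive1P hy e e0.
have e2 : 0 < e / 2 by rewrite divr_gt0.
near=> s; rewrite (le_trans (normc_leD _))//.
rewrite (_ : complex.Re _ = x s - x t - (s - t) * dx); last by rewrite /=; ring.
rewrite (_ : complex.Im _ = y s - y t - (s - t) * dy); last by rewrite /=; ring.
rewrite (splitr e) [leRHS]mulrDl lerD//; near: s; [exact: hx|exact: hy].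
Unshelve. all: by end_near. Qed.

Lemma has_wirtingerD f1 f2 z k1 k2 l1 l2 : has_wirtinger f1 z k1 l1 -> has_wirtinger f2 z k2 l2 ->
  has_wirtinger (fun w => f1 w + f2 w) z (k1 + k2) (l1 + l2).
Proof.
move=> h1 h2 e e0; have e2 : 0 < e / 2 by rewrite divr_gt0.
near=> w.
rewrite (_ : _ - _ = (f1 w - f1 z - (k1 * (w - z) + l1 * conjc (w - z))) +
  (f2 w - f2 z - (k2 * (w - z) + l2 * conjc (w - z)))); last by ring.
rewrite (le_trans (ler_normcD _ _))// (splitr e) [leRHS]mulrDl lerD//; near: w;
  [exact: h1|exact: h2].
Unshelve. all: by end_near. Qed.

Lemma has_wirtinger_conj f z k l : has_wirtinger f z k l ->
  has_wirtinger (conjc \o f) z (conjc l) (conjc k).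
Proof.
move=> h e /h; apply: filterS => w; rewrite -normc_conj; congr (normc _ <= _).
rewrite /=; case: (f w) (f z) k l (w - z) h => [? ?] [? ?] [? ?] [? ?] [? ?] _ /=.
by simpc; congr Complex; ring.
Qed.

Lemma near_has_wirtinger f1 f2 z k l :
  (\forall w \near z, f1 w = f2 w) -> has_wirtinger f1 z k l -> has_wirtinger f2 z k l.
Proof.
move=> f12 h e /h; have fz := nbhs_singleton f12.
by apply: filterS2 f12 => w; rewrite fz => ->.
Qed.

(** The partial derivatives of f at z are the velocities of f along the
    horizontal and the vertical line through z, namely k + l and i (k - l). *)
Lemma has_wirtinger_f_z (f : R[i] -> R[i]) z k l :
  has_wirtinger f z k l -> f_z f z = k /\ f_zbar f z = l.
Proof.
move=> fz; case: z fz => x y fz.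
have vx : velocity (fun s : R => s +i* y) x (1 +i* 0).
  by apply: velocity_complex.
have vy : velocity (fun s : R => x +i* s) y (0 +i* 1).
  by apply: velocity_complex.
have dE (c : R -> R[i]) (t : R) (d : R[i]) : velocity c t d ->
    derive1 (fun s => complex.Re (c s)) t = complex.Re d /\
    derive1 (fun s => complex.Im (c s)) t = complex.Im d.
  move=> ct; rewrite !derive1E; split.
    rewrite -[d]mul1r; have [_ <-] := velocity_Re 1 ct.
    by congr ('D_1 _ t); apply/funext => s; rewrite mul1r.
  have imE w : complex.Im w = complex.Re ((0 -i* 1) * w).
    by case: w => a b /=; ring.
  rewrite imE; have [_ <-] := velocity_Re (0 -i* 1) ct.
  by congr ('D_1 _ t); apply/funext => s; rewrite imE.
have [x1 x2] := dE _ _ _ (velocity_comp (c := fun s : R => s +i* y) fz vx).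
have [y1 y2] := dE _ _ _ (velocity_comp (c := fun s : R => x +i* s) fz vy).
rewrite /f_z /f_zbar /f_x /f_y /dx /dy /re_part /im_part /=.
rewrite /comp in x1 x2 y1 y2; rewrite x1 x2 y1 y2 -?complexiE.
by case: k l {fz x1 x2 y1 y2 dE} => [k1 k2] [l1 l2]; split; rewrite -[RHS](@mulfK _ 2%:R) ?pnatr_eq0//;
  congr (_ / _); simpc; congr (_ +i* _); rewrite /=; ring.
Qed.

End ComplexTopology.

(** * Series of complex numbers *)

Section Series.
Variable R : realType.
Implicit Types (z w : R[i]) (x y e : R).

Lemma ler_normc_sum (I : Type) (s : seq I) (P : pred I) (F : I -> R[i]) :
  normc (\sum_(i <- s | P i) F i) <= \sum_(i <- s | P i) normc (F i).
Proof.
elim/big_ind2 : _ => [|a x b y ax byy|//]; first by rewrite Normc.normc0.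
by rewrite (le_trans (ler_normcD _ _))// lerD.
Qed.

Lemma cvg_normc_le (T : Type) (F : set_system T) {FF : ProperFilter F}
    (u : T -> R[i]) (l : R[i]) (B : R) : u @ F --> l ->
  (\forall t \near F, normc (u t) <= B) -> normc l <= B.
Proof.
move=> /cvgC_normcP ul uB; rewrite leNgt; apply/negP => Bl.
have e0 : 0 < normc l - B by rewrite subr_gt0.
have [t [h1 h2]] := filter_ex (filterI (ul _ e0) uB).
have := ler_normcD (l - u t) (u t); rewrite subrK normcB; lra.
Qed.

Lemma bounded_sum_tail (u : R^nat) (K e : R) : (forall n, 0 <= u n) ->
  (forall n, \sum_(0 <= i < n) u i <= K) -> 0 < e ->
  exists N, forall M, (N <= M)%N -> \sum_(N <= i < M) u i <= e.
Proof.
move=> u0 uK e0.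
have mono : {homo series u : n m / (n <= m)%N >-> n <= m}.
  by move=> n m nm; rewrite /series/= (big_cat_nat (leq0n n) nm)//= lerDl sumr_ge0.
have ub : has_ubound (range (series u)) by exists K => _ [n _ <-]; exact: uK.
have cv := nondecreasing_is_cvgn mono ub.
have leL n : series u n <= limn (series u) by exact: nondecreasing_cvgn_le.
have /cvgrPdist_lt/(_ e e0)[N _ hN] := cv.
exists N => M NM; have := hN N (leqnn N) => /=.
have := leL M; rewrite /series/= (big_cat_nat (leq0n N) NM)//=; have := leL N.
by rewrite /series/= ltr_norml => h1 h2 /andP[_ h3]; lra.
Qed.

(** Absolutely convergent series converge, by completeness of R applied to the
    real and the imaginary parts. *)
Lemma normc_series_cvg (u : (R[i])^nat) (K : R) :
  (forall n, \sum_(0 <= i < n) normc (u i) <= K) ->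
  exists l : R[i], series u @ \oo --> l.
Proof.
move=> uK.
have comp (p : R[i] -> R) (pD : {morph p : a b / a + b}) (p0 : p 0 = 0)
    (ple : forall z, `|p z| <= normc z) : cvgn (series (p \o u)).
  apply: normed_cvg; apply: nondecreasing_is_cvgn.
    move=> n m nm; rewrite /= /series/= (big_cat_nat (leq0n n) nm)/= lerDl.
    by rewrite sumr_ge0.
  exists K => _ [n _ <-]; rewrite (le_trans _ (uK n))// /= /series/=.
  by apply: ler_sum => i _; exact: ple.
have cre := comp (@complex.Re R) ltac:(by case=> ? ? [? ?]) erefl (@Re_le_normc R).
have cim := comp (@complex.Im R) ltac:(by case=> ? ? [? ?]) erefl (@Im_le_normc R).
exists (limn (series (@complex.Re R \o u)) +i* limn (series (@complex.Im R \o u))).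
rewrite [X in X @ _ --> _](_ : _ = fun n =>
  series (@complex.Re R \o u) n +i* series (@complex.Im R \o u) n).
  exact: cvg_complex.
apply/funext => n; rewrite /series/=.
elim: n => [|n IHn]; first by rewrite !big_geq.
by rewrite !big_nat_recr//= IHn; case: (u n).
Qed.

Lemma geometric_sum_le x n : 0 <= x < 1 -> \sum_(0 <= i < n) x ^+ i <= (1 - x)^-1.
Proof.
move=> /andP[x0 x1]; have x1' : 0 < 1 - x by rewrite subr_gt0.
rewrite -[leRHS]mul1r ler_pdivlMr// (_ : _ * _ = 1 - x ^+ n).
  by rewrite gerBl exprn_ge0.
elim: n => [|n IHn]; first by rewrite big_geq// mul0r expr0 subrr.
by rewrite big_nat_recr//= mulrDl IHn exprS; ring.
Qed.

(** From the closed form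
    (1 - x)^2 \sum_(i < n+1) i x^(i-1) = 1 - (n+1) x^n + n x^(n+1). *)
Lemma geometric_deriv_sum_le x n : 0 <= x < 1 ->
  \sum_(0 <= i < n) i%:R * x ^+ i.-1 <= ((1 - x) ^+ 2)^-1.
Proof.
move=> /andP[x0 x1]; have x1' : 0 < (1 - x) ^+ 2 by rewrite exprn_gt0// subr_gt0.
rewrite -[leRHS]mul1r ler_pdivlMr//.
case: n => [|n]; first by rewrite big_geq// mul0r.
rewrite (_ : _ * _ = 1 - n.+1%:R * x ^+ n + n%:R * x ^+ n.+1).
  rewrite -addrA gerDl exprS addrC subr_le0 mulrA ler_wpM2r ?exprn_ge0//.
  by rewrite (@le_trans _ _ n%:R) ?ler_nat// ler_piMr// ltW.
elim: n => [|n IHn]; first by rewrite big_nat1 !mul0r mul1r expr0; ring.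
by rewrite big_nat_recr//= mulrDl IHn !exprS -!natr1; ring.
Qed.

Lemma normc_powB_le z w n : normc z <= 1 -> normc w <= 1 ->
  normc (z ^+ n - w ^+ n) <= n%:R * normc (z - w).
Proof.
move=> z1 w1; elim: n => [|n IHn]; first by rewrite subrr mul0r Normc.normc0.
rewrite (_ : _ - _ = z * (z ^+ n - w ^+ n) + (z - w) * w ^+ n); last first.
  by rewrite !exprS; ring.
rewrite (le_trans (ler_normcD _ _))// !Normc.normcM -natr1 mulrDl mul1r lerD//.
  by rewrite (le_trans _ IHn)// ler_piMl// normc_ge0.
by rewrite ler_piMr ?normc_ge0// normcX exprn_ile1// normc_ge0.
Qed.

(** The remainders r_n = w^n - z^n - n z^(n-1) (w - z) satisfy
    r_(n+1) = w r_n + n z^(n-1) (w - z)^2.  The explicit factor n of the bound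
    is there to be absorbed by the boundedness of n c_n; it costs a factor 2. *)
Lemma normc_pow_taylor_le z w x n : normc z <= x -> normc w <= x ->
  normc (w ^+ n.+1 - z ^+ n.+1 - n.+1%:R * z ^+ n * (w - z)) <=
  n.+1%:R * (n%:R * x ^+ n.-1) * normc (w - z) ^+ 2.
Proof.
move=> zx wx; have x0 : 0 <= x := le_trans (normc_ge0 _) zx.
elim: n => [|n IHn].
  by rewrite (_ : _ - _ = 0) ?Normc.normc0 ?mul0r ?mulr0 ?mul0r//; ring.
rewrite (_ : _ - _ = w * (w ^+ n.+1 - z ^+ n.+1 - n.+1%:R * z ^+ n * (w - z)) +
  n.+1%:R * z ^+ n * (w - z) ^+ 2); last first.
  by rewrite !exprS -!natr1; ring.
rewrite (le_trans (ler_normcD _ _))// !Normc.normcM normcX normc_nat -expr2 /=.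
rewrite (@le_trans _ _ (x * (n.+1%:R * (n%:R * x ^+ n.-1) * normc (w - z) ^+ 2)
  + n.+1%:R * x ^+ n * normc (w - z) ^+ 2))// ?lerD ?ler_pM ?normc_ge0//.
- by rewrite mulr_ge0// exprn_ge0// normc_ge0.
- by rewrite exprn_ge0// normc_ge0.
- by rewrite exprn_ge0// normc_ge0.
- by rewrite lerXn2r ?nnegrE ?normc_ge0.
rewrite mulrA -mulrDl ler_wpM2r ?sqr_ge0//.
have -> : x * (n.+1%:R * (n%:R * x ^+ n.-1)) = n.+1%:R * n%:R * x ^+ n.
  by case: n {IHn} => [|n]; rewrite ?exprS/=; ring.
rewrite [leRHS]mulrA -mulrDl ler_wpM2r ?exprn_ge0// -!natr1.
have : 0 <= (n%:R : R) by []. nra.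
Qed.

End Series.

(** * Power series and the coefficients of (1 - z^2) k' *)

Section PowerSeries.
Variable R : realType.
Implicit Types (z w : R[i]) (x y e : R) (c : nat -> R[i]) (k : R[i] -> R[i]).

Definition deriv_coef c n : R[i] := n.+1%:R * c n.+1.

(** Termwise differentiation.  Since n c_n is bounded, the second-order
    remainders of the monomials add up to at most a constant times |w - z|^2. *)
Lemma power_series_has_wirtinger c k (K : R) :
  (forall n, normc (deriv_coef c n) <= K) ->
  (forall z, unit_disk z -> series (fun n => c n * z ^+ n) @ \oo --> k z) ->
  forall z, unit_disk z -> exists2 d : R[i],
    series (fun n => deriv_coef c n * z ^+ n) @ \oo --> d & has_wirtinger k z d 0.
Proof.
move=> cK kE z zD; have z1 : normc z < 1 := zD.
have K0 : 0 <= K := le_trans (normc_ge0 _) (cK 0%N).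
have [d dE] : exists d : R[i], series (fun n => deriv_coef c n * z ^+ n) @ \oo --> d.
  apply: (@normc_series_cvg _ _ (K * (1 - normc z)^-1)) => n.
  have := @geometric_sum_le _ (normc z) n; rewrite normc_ge0 z1 => /(_ isT) zle.
  rewrite (le_trans _ (ler_wpM2l K0 zle))// mulr_sumr ler_sum// => i _.
  by rewrite Normc.normcM normcX ler_wpM2r// exprn_ge0// normc_ge0.
exists d => // e e0.
pose x := (1 + normc z) / 2.
have x01 : 0 <= x < 1 by have := normc_ge0 z; rewrite /x => ?; lra.
have zx : normc z < x by rewrite /x; lra.
pose B := K * ((1 - x) ^+ 2)^-1.
have B0 : 0 <= B by rewrite mulr_ge0// invr_ge0 sqr_ge0.
have r0 : 0 < Num.min (x - normc z) (e / (B + 1)).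
  by rewrite lt_min subr_gt0 zx divr_gt0// ltr_wpDl.
have := near_normc z r0; apply: filterS => w; rewrite lt_min => /andP[wz we].
have wx : normc w <= x.
  by have := ler_normcD (w - z) z; rewrite subrK; lra.
have w1 : normc w < 1 by lra.
rewrite mul0r addr0.
apply: (@le_trans _ _ (B * normc (w - z) ^+ 2)); last first.
  rewrite expr2 mulrA ler_wpM2r ?normc_ge0//.
  rewrite ltr_pdivlMr in we; last by rewrite ltr_wpDl.
  by have := normc_ge0 (w - z); lra.
have L : (fun n => series (fun n => c n * w ^+ n) n.+1 -
    series (fun n => c n * z ^+ n) n.+1 -
    (w - z) * series (fun n => deriv_coef c n * z ^+ n) n) @ \oo -->
    k w - k z - (w - z) * d.
  exact: (cvgC_B (cvgC_B (cvgC_shiftS (kE w w1)) (cvgC_shiftS (kE z zD))) (cvgC_mull dE)).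
rewrite [d * _]mulrC; apply: (cvg_normc_le L).
apply: nearW => n /=.
have -> : series (fun n => c n * w ^+ n) n.+1 - series (fun n => c n * z ^+ n) n.+1
   - (w - z) * series (fun n => deriv_coef c n * z ^+ n) n =
   \sum_(0 <= i < n) c i.+1 * (w ^+ i.+1 - z ^+ i.+1 - i.+1%:R * z ^+ i * (w - z)).
  rewrite /series/= !big_nat_recl// !expr0 opprD addrACA subrr add0r.
  rewrite mulr_sumr -!sumrB; apply: eq_bigr => i _; rewrite /deriv_coef; ring.
rewrite (le_trans (ler_normc_sum _ _ _))//.
have := @geometric_deriv_sum_le _ x n x01 => /(ler_wpM2l K0) gle.
rewrite (le_trans _ (ler_wpM2r (sqr_ge0 _) gle))// mulr_sumr mulr_suml ler_sum// => i _.
rewrite Normc.normcM (le_trans (ler_wpM2l _ (normc_pow_taylor_le i (ltW zx) wx)))//.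
  exact: normc_ge0.
have := cK i; rewrite /deriv_coef Normc.normcM normc_nat => ci.
rewrite [leLHS]mulrA ler_wpM2r ?sqr_ge0//.
rewrite [leLHS](_ : _ = i.+1%:R * normc (c i.+1) * (i%:R * x ^+ i.-1)); last by ring.
by rewrite ler_wpM2r// mulr_ge0// exprn_ge0//; case/andP: x01.
Qed.

(** If k is the sum of c_n z^n, this is the n-th coefficient of (1 - z^2) k';
    for n = 0 the convention 0.-1 = 0 makes it c_1. *)
Definition weighted_coef c n : R[i] := n.+1%:R * c n.+1 - n.-1%:R * c n.-1.

(** The recurrence (n+2) c_(n+2) = [weighted_coef c (n+1)] + n c_n telescopes, with
    steps of 2. *)
Lemma deriv_coef_le c (K : R) : (forall n, \sum_(0 <= i < n) normc (weighted_coef c i) <= K) ->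
  forall n, normc (deriv_coef c n) <= K.
Proof.
move=> cK n; apply: le_trans (cK n.+1).
have [] : normc (deriv_coef c n) <= \sum_(0 <= i < n.+1) normc (weighted_coef c i) /\
  normc (deriv_coef c n.+1) <= \sum_(0 <= i < n.+2) normc (weighted_coef c i); last by [].
elim: n => [|n [IHn IHn1]].
  rewrite !big_nat_recr//= big_geq// /deriv_coef /weighted_coef /= !mul0r !subr0 add0r.
  by split=> //; rewrite lerDr normc_ge0.
split=> //; rewrite big_nat_recr//= [leRHS]addrC big_nat_recr//=.
have -> : deriv_coef c n.+2 = weighted_coef c n.+2 + deriv_coef c n.
  by rewrite /deriv_coef /weighted_coef /= subrK.
rewrite (le_trans (ler_normcD _ _))// lerD// (le_trans IHn)// lerDl normc_ge0//.
Qed.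

Lemma weighted_series_cvg c z (d : R[i]) :
  series (fun n => deriv_coef c n * z ^+ n) @ \oo --> d ->
  series (fun n => weighted_coef c n * z ^+ n) @ \oo --> (1 - z ^+ 2) * d.
Proof.
move=> dE; apply: cvgC_unshiftS; apply: cvgC_unshiftS.
have -> : (1 - z ^+ 2) * d = d - z ^+ 2 * d by ring.
rewrite [X in X @ _ --> _](_ : _ = fun n => series (fun n => deriv_coef c n * z ^+ n) n.+2 -
  z ^+ 2 * series (fun n => deriv_coef c n * z ^+ n) n); last first.
  apply/funext => n; rewrite /series/= mulr_sumr !big_nat_recl//=.
  rewrite /weighted_coef /= !mul0r !subr0 -!addrA; congr (_ + (_ + _)).
  rewrite -sumrB; apply: eq_bigr => i _; rewrite /deriv_coef !exprS; ring.
exact: (cvgC_B (cvgC_shiftS (cvgC_shiftS dE)) (cvgC_mull dE)).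
Qed.

(** Weierstrass: the tails are uniformly small on the disk, and each of the
    finitely many remaining monomials is Lipschitz there. *)
Lemma power_series_unif_continuous (u : nat -> R[i]) (k : R[i] -> R[i]) (K : R) :
  (forall n, \sum_(0 <= i < n) normc (u i) <= K) ->
  (forall z, unit_disk z -> series (fun n => u n * z ^+ n) @ \oo --> k z) ->
  forall e, 0 < e -> exists2 r : R, 0 < r & forall z w, unit_disk z -> unit_disk w ->
    normc (z - w) < r -> normc (k z - k w) <= e.
Proof.
move=> uK kE e e0; have e4 : 0 < e / 4 by rewrite divr_gt0.
have K0 : 0 <= K by have := uK 0%N; rewrite big_geq.
have [N hN] := bounded_sum_tail (fun n => normc_ge0 (u n)) uK e4.
have KN : 0 < 2 * (K * N%:R + 1) by rewrite mulr_gt0// ltr_wpDl// mulr_ge0.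
exists (e / (2 * (K * N%:R + 1))) => [|z w zD wD]; first by rewrite divr_gt0.
rewrite ltr_pdivlMr// => zw.
have z1 : normc z <= 1 by exact: ltW zD.
have w1 : normc w <= 1 by exact: ltW wD.
apply: (cvg_normc_le (cvgC_B (kE z zD) (kE w wD))).
exists N => // M /= NM.
rewrite /series/= -sumrB (big_cat_nat (leq0n N) NM)/=.
rewrite (le_trans (ler_normcD _ _))// (splitr e) lerD//.
  apply: (@le_trans _ _ (K * (N%:R * normc (z - w)))); last first.
    have := normc_ge0 (z - w); lra.
  have := ler_wpM2r (_ : 0 <= N%:R * normc (z - w)) (uK N).
  rewrite mulr_ge0 ?normc_ge0// => /(_ isT); apply: le_trans.
  rewrite (le_trans (ler_normc_sum _ _ _))// mulr_suml ler_sum_nat// => i /andP[_ iN].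
  rewrite -mulrBr Normc.normcM ler_wpM2l ?normc_ge0//.
  rewrite (le_trans (normc_powB_le _ _ _))// ler_wpM2r ?normc_ge0// ler_nat ltnW//.
rewrite (le_trans (ler_normc_sum _ _ _))//.
have := ler_wpM2r (ler0n R 2) (hN _ NM).
(* each tail term is at most 2 |u_i|, whence the choice of e / 4 *)
rewrite mulr_suml (_ : e / 4 * 2 = e / 2); last by field.
apply: le_trans; apply: ler_sum => i _.
rewrite -mulrBr Normc.normcM ler_wpM2l ?normc_ge0//.
have := ler_normcD (z ^+ i) (- w ^+ i); rewrite normc_opp !normcX.
have : normc z ^+ i <= 1 by rewrite exprn_ile1// normc_ge0.
have : normc w ^+ i <= 1 by rewrite exprn_ile1// normc_ge0.
lra.
Qed.

End PowerSeries.

(** * The conformal map from the strip to the disk *)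

Section StripMap.
Variable R : realType.
Implicit Types (z w : R[i]) (u v e : R).

(** exp (2 w) for w = u + i v: it maps the strip |v| < pi / 4 onto the right
    half-plane. *)
Definition strip_exp u v : R[i] :=
  (expR (2 * u) * cos (2 * v)) +i* (expR (2 * u) * sin (2 * v)).

Definition mobius z : R[i] := (z - 1) / (z + 1).

(** tanh (u + i v) = (exp (2 w) - 1) / (exp (2 w) + 1). *)
Definition strip_map u v : R[i] := mobius (strip_exp u v).

Definition in_strip v := `|v| < pi / 4.

(** The remainder of the first-order expansion is exactly
    - 2 (w - z)^2 / ((w + 1) (z + 1)^2). *)
Lemma mobius_has_wirtinger z : z + 1 != 0 -> has_wirtinger mobius z (2%:R / (z + 1) ^+ 2) 0.
Proof.
move=> z0 e e0.
have n0 : 0 < normc (z + 1).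
  by rewrite lt_neqAle normc_ge0 andbT eq_sym; apply: contra z0 => /eqP/Normc.eq0_normc->.
pose m := normc (z + 1).
(* for |w - z| < m / 2 one has |w + 1| > m / 2, so the remainder is at most 4 |w - z|^2 / m^3 *)
have r0 : 0 < Num.min (m / 2) (e * m ^+ 3 / 4).
  by rewrite lt_min !divr_gt0// mulr_gt0// exprn_gt0.
have := near_normc z r0; apply: filterS => w; rewrite lt_min => /andP[w1 w2].
have wm : m / 2 < normc (w + 1).
  have := ler_normcD (w + 1) (z - w).
  rewrite (_ : w + 1 + (z - w) = z + 1); last by ring.
  by rewrite [normc (z - w)]normcB -/m; lra.
have m0 : 0 < m by [].
have w0 : w + 1 != 0.
  apply/eqP => w0; move: wm; rewrite w0 Normc.normc0; lra.
rewrite (_ : _ - _ = (w - z) * ((w - z) * (- 2%:R / ((w + 1) * (z + 1) ^+ 2)))); last first.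
  by rewrite /mobius; field; rewrite z0 w0.
rewrite Normc.normcM mulrC ler_wpM2r ?normc_ge0//.
rewrite !Normc.normcM Normc.normcV normc_opp normc_nat Normc.normcM normcX -/m.
have d0 : 0 < normc (w + 1) * m ^+ 2 by rewrite mulr_gt0 ?exprn_gt0//; lra.
rewrite mulrA ler_pdivrMr// (@le_trans _ _ (e * (m / 2 * m ^+ 2)))//.
  by rewrite (_ : e * _ = e * m ^+ 3 / 4 * 2) ?ler_wpM2r// ?ltW//; field.
by rewrite ler_wpM2l ?(ltW e0)// ler_wpM2r ?sqr_ge0// ltW.
Qed.

Lemma Re_strip_exp_gt0 u v : in_strip v -> 0 < complex.Re (strip_exp u v).
Proof.
rewrite /in_strip ltr_norml => /andP[v1 v2].
by rewrite mulr_gt0 ?expR_gt0// cos_gt0_pihalf//; apply/andP; split; lra.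
Qed.

Lemma strip_expD1_neq0 u v : in_strip v -> strip_exp u v + 1 != 0.
Proof.
move=> /(Re_strip_exp_gt0 u); case: (strip_exp u v) => x y /= x0.
by rewrite eq_complex /= negb_and gt_eqF// ltr_wpDr.
Qed.

Lemma mobius_disk z : 0 < complex.Re z -> unit_disk (mobius z).
Proof.
move=> z0; rewrite /unit_disk /= /mobius Normc.normcM Normc.normcV.
have z1 : 0 < normc (z + 1).
  by have := Re_le_normc (z + 1); case: z z0 => x y /= x0; rewrite ger0_norm; lra.
rewrite ltr_pdivrMr// mul1r -(@ltr_pXn2r _ 2) ?nnegrE ?normc_ge0//.
by rewrite !sqr_normcE; case: z z0 {z1} => x y /= x0; nra.
Qed.

Lemma strip_map_disk u v : in_strip v -> unit_disk (strip_map u v).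
Proof. by move=> /(Re_strip_exp_gt0 u)/mobius_disk. Qed.

Lemma normc_strip_exp u v : normc (strip_exp u v) = expR (2 * u).
Proof.
rewrite /strip_exp /= !exprMn -mulrDr cos2Dsin2 mulr1 sqrtr_sqr.
by rewrite ger0_norm// expR_ge0.
Qed.

(** The inverse image of z in the right half-plane is s = (1 + z) / (1 - z); its
    modulus gives u and its argument, which lies in ]-pi/2, pi/2[, gives v. *)
Lemma strip_map_surj z : unit_disk z -> exists u v, in_strip v /\ strip_map u v = z.
Proof.
move=> zD; have z1 : normc z < 1 := zD.
have z1N : 1 - z != 0.
  by apply/eqP => /subr0_eq h; move: z1; rewrite -h Normc.normc1 ltxx.
pose s := (1 + z) / (1 - z).
have sm : mobius s = z.
  rewrite /mobius /s; field; rewrite z1N /=.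
  by rewrite addrCA -addrA subrr addr0 (pnatr_eq0 _ 2).
have s0 : 0 < complex.Re s.
  rewrite /s; have : normc z ^+ 2 < 1 by rewrite expr_lt1// normc_ge0.
  rewrite sqr_normcE; case: (z) => x y /= xy; rewrite !add0r.
  have x1 : 0 < 1 - x by have := sqr_ge0 y; nra.
  have d0 : 0 < (1 - x) ^+ 2 + (- y) ^+ 2 by rewrite ltr_pwDl ?sqr_ge0// exprn_gt0.
  rewrite (_ : _ - _ = (1 - x ^+ 2 - y ^+ 2) / ((1 - x) ^+ 2 + (- y) ^+ 2)).
    by rewrite divr_gt0//; lra.
  by field; rewrite gt_eqF.
have n0 : 0 < normc s.
  by rewrite (lt_le_trans s0)// (le_trans (ler_norm _))// Re_le_normc.
pose q := complex.Im s / normc s.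
have q1 : -1 < q < 1.
  rewrite -ltr_norml /q normrM normfV (ger0_norm (normc_ge0 _)) ltr_pdivrMr// mul1r.
  rewrite -(@ltr_pXn2r _ 2) ?nnegrE ?normc_ge0// sqr_normcE real_normK ?num_real//.
  by rewrite ltrDr exprn_gt0.
exists (ln (normc s) / 2), (asin q / 2); split.
  have [q1l q1r] := andP q1.
  rewrite /in_strip ltr_norml; have := asin_ltpi2 (_ : -1 <= q < 1).
  have := asin_gtNpi2 (_ : -1 < q <= 1).
  rewrite q1l q1r !ltW// => /(_ isT) h1 /(_ isT) h2.
  by apply/andP; split; lra.
rewrite /strip_map -[RHS]sm; congr mobius.
rewrite /strip_exp !(mulrC 2) !mulfVK ?pnatr_eq0// lnK ?posrE//.
rewrite asinK ?in_itv/= ?(ltW (andP q1).1) ?(ltW (andP q1).2)//.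
rewrite cos_asin ?(ltW (andP q1).1) ?(ltW (andP q1).2)//.
rewrite [RHS](_ : s = complex.Re s +i* complex.Im s); last by case: (s).
congr (_ +i* _); last by rewrite /q mulrCA mulfV ?mulr1// gt_eqF.
rewrite (_ : 1 - q ^+ 2 = (complex.Re s / normc s) ^+ 2).
  rewrite sqrtr_sqr ger0_norm ?divr_ge0 ?ltW// mulrCA mulfV ?mulr1// gt_eqF//.
have : normc s ^+ 2 = complex.Re s ^+ 2 + complex.Im s ^+ 2 by exact: sqr_normcE.
rewrite /q !expr_div_n => h; apply: (@mulIf _ (normc s ^+ 2)).
  by rewrite expf_neq0// gt_eqF.
by rewrite mulrBl !divfK ?expf_neq0 ?gt_eqF// mul1r h addrK.
Qed.

Lemma strip_exp_velocity u v (du dv t : R) :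
  velocity (fun s => strip_exp (u + s * du) (v + s * dv)) t
    (2%:R * (du +i* dv) * strip_exp (u + t * du) (v + t * dv)).
Proof.
have lin (p q : R) : is_derive t 1 (fun s => 2 * (p + s * q)) (2 * q).
  apply/is_derive1P => e e0; near=> s.
  have -> : 2 * (p + s * q) - 2 * (p + t * q) - (s - t) * (2 * q) = 0 by ring.
  by rewrite normr0 mulr_ge0// ltW.
have de := is_derive1_comp (is_derive_expR _) (lin u du).
have dc := is_derive1_comp (is_derive_cos _) (lin v dv).
have ds := is_derive1_comp (is_derive_sin _) (lin v dv).
have -> : 2%:R * (du +i* dv) * strip_exp (u + t * du) (v + t * dv) =
  (expR (2 * (u + t * du)) *: (- sin (2 * (v + t * dv)) * (2 * dv)) +
    cos (2 * (v + t * dv)) *: (expR (2 * (u + t * du)) * (2 * du))) +i*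
  (expR (2 * (u + t * du)) *: (cos (2 * (v + t * dv)) * (2 * dv)) +
    sin (2 * (v + t * dv)) *: (expR (2 * (u + t * du)) * (2 * du))).
  by rewrite /strip_exp /GRing.scale /=; simpc; congr (_ +i* _); ring.
by apply: velocity_complex; exact: is_deriveM.
Unshelve. all: by end_near. Qed.

(** The equation tanh' = 1 - tanh^2 along straight lines. *)
Lemma strip_map_velocity u v (du dv t : R) : in_strip (v + t * dv) ->
  velocity (fun s => strip_map (u + s * du) (v + s * dv)) t
    ((du +i* dv) * (1 - strip_map (u + t * du) (v + t * dv) ^+ 2)).
Proof.
move=> vt; have e0 := strip_expD1_neq0 (u + t * du) vt.
have := velocity_comp (c := fun s => strip_exp (u + s * du) (v + s * dv))
  (mobius_has_wirtinger e0) (@strip_exp_velocity u v du dv t).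
congr velocity; rewrite mul0r addr0 /strip_map /mobius.
by move: (strip_exp _ _) e0 => x e0; field.
Qed.

Lemma strip_map_continuous u v : in_strip v ->
  {for (u, v), continuous (fun p : R * R => strip_map p.1 p.2)}.
Proof.
move=> vs; have e0 := strip_expD1_neq0 u vs.
apply: (@continuous_comp _ _ _ (fun p : R * R => strip_exp p.1 p.2) mobius); last first.
  exact: (has_wirtinger_continuous (mobius_has_wirtinger e0)).
have c1 : (fun p : R * R => 2 * p.1) @ nbhs (u, v) --> 2 * u.
  by apply: cvgMr; exact: cvg_fst.
have c2 : (fun p : R * R => 2 * p.2) @ nbhs (u, v) --> 2 * v.
  by apply: cvgMr; exact: cvg_snd.
have ce := cvg_comp _ _ c1 (@continuous_expR R (2 * u)).
have cc := cvg_comp _ _ c2 (@continuous_cos R (2 * v)).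
have cs := cvg_comp _ _ c2 (@continuous_sin R (2 * v)).
by apply: cvg_complex; apply: cvgM.
Qed.

(** In the right half-plane, |s + 1|^2 = |s|^2 + 2 Re s + 1 exceeds both |s|^2
    and 1. *)
Lemma normcD_strip_exp_ge u v : in_strip v -> expR (2 * u) <= normc (strip_exp u v + 1)
  /\ 1 <= normc (strip_exp u v + 1).
Proof.
move=> /(Re_strip_exp_gt0 u) x0; rewrite -(normc_strip_exp u v).
have h : normc (strip_exp u v + 1) ^+ 2 =
  normc (strip_exp u v) ^+ 2 + 2 * complex.Re (strip_exp u v) + 1.
  by rewrite !sqr_normcE; case: (strip_exp u v) => x y /=; ring.
split; rewrite -(@ler_pXn2r _ 2) ?nnegrE ?normc_ge0// h; last first.
  by have := sqr_ge0 (normc (strip_exp u v)); lra.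
lra.
Qed.

Lemma strip_map_near1 u v : in_strip v -> normc (strip_map u v - 1) <= 2 * expR (- (2 * u)).
Proof.
move=> vs; have [h1 h2] := normcD_strip_exp_ge u vs.
have e0 := strip_expD1_neq0 u vs.
rewrite /strip_map /mobius (_ : _ - 1 = - 2%:R / (strip_exp u v + 1)); last by field.
rewrite Normc.normcM Normc.normcV normc_opp normc_nat ler_pM2l// expRN lef_pV2//.
  by rewrite posrE; lra.
by rewrite posrE expR_gt0.
Qed.

Lemma strip_map_nearN1 u v : in_strip v -> normc (strip_map u v + 1) <= 2 * expR (2 * u).
Proof.
move=> vs; have [h1 h2] := normcD_strip_exp_ge u vs.
have e0 := strip_expD1_neq0 u vs.
rewrite /strip_map /mobius (_ : _ + 1 = 2%:R * strip_exp u v / (strip_exp u v + 1)); last by field.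
rewrite !Normc.normcM Normc.normcV normc_nat normc_strip_exp ler_pdivrMr; last by lra.
by rewrite ler_peMr// mulr_ge0// expR_ge0.
Qed.

End StripMap.

(** * Level curves of a strictly monotone map of a strip *)

Section LevelCurves.
Variables (R : realType) (tau : R) (Phi Psi : R -> R -> R).
Implicit Types (u v c y e : R).

Hypothesis Phi_cont : forall u v, `|v| < tau ->
  {for (u, v), continuous (fun p : R * R => Phi p.1 p.2)}.
Hypothesis Psi_cont : forall u v, `|v| < tau ->
  {for (u, v), continuous (fun p : R * R => Psi p.1 p.2)}.
(* (Phi, Psi) is strictly monotone as a vector field: the increments of the
   map and of the point have a positive scalar product. *)
Hypothesis mono : forall u v u' v', `|v| < tau -> `|v'| < tau ->
  (u, v) <> (u', v') ->
  0 < (Phi u' v' - Phi u v) * (u' - u) + (Psi u' v' - Psi u v) * (v' - v).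
Definition image_section c : set R :=
  [set y | exists u v, [/\ `|v| < tau, Phi u v = c & Psi u v = y]].

Lemma monotone_incr v u u' : `|v| < tau -> u < u' -> Phi u v < Phi u' v.
Proof.
move=> vt uu; have := @mono u v u' v vt vt; rewrite subrr mulr0 addr0.
rewrite pmulr_lgt0 ?subr_gt0//; apply => -[]; lra.
Qed.

(* The heights at which Phi takes the value c form an interval. *)
Hypothesis level_convex : forall c u1 v1 u2 v2 v, `|v1| < tau -> `|v2| < tau ->
  v1 < v < v2 -> Phi u1 v1 = c -> Phi u2 v2 = c -> exists u, Phi u v = c.

Let Phi_inj v u u' : `|v| < tau -> Phi u v = Phi u' v -> u = u'.
Proof.
move=> vt e; apply/eqP; rewrite eq_le !leNgt; apply/andP; split; apply/negP.
  by move=> /(monotone_incr vt); rewrite e ltxx.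
by move=> /(monotone_incr vt); rewrite e ltxx.
Qed.

Let cont_v (F : R -> R -> R) u v :
  {for (u, v), continuous (fun p : R * R => F p.1 p.2)} ->
  (fun w => F u w) @ v --> F u v.
Proof.
move=> Fc; have h : (fun w => (u, w)) @ nbhs v --> (u, v).
  exact: (cvg_pair (cvg_cst u) cvg_id).
exact: (cvg_comp _ _ h Fc).
Qed.

Let cont_u (F : R -> R -> R) u v :
  {for (u, v), continuous (fun p : R * R => F p.1 p.2)} ->
  (fun w => F w v) @ u --> F u v.
Proof.
move=> Fc; have h : (fun w => (w, v)) @ nbhs u --> (u, v).
  exact: (cvg_pair cvg_id (cvg_cst v)).
exact: (cvg_comp _ _ h Fc).
Qed.

Let near_strip v : `|v| < tau -> \forall w \near v, `|w| < tau.
Proof.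
move=> vt; have r0 : 0 < tau - `|v| by rewrite subr_gt0.
have : \forall w \near v, `|v - w| < tau - `|v|.
  exact: (nbhsx_ballx v _ r0).
apply: filterS => w h; have := ler_normD v (w - v).
by rewrite addrCA subrr addr0 distrC; lra.
Qed.

(** Implicit function theorem for the increasing functions Phi(., v): around
    (Phi u0 v0, v0), every level c is reached at every height v, near u0.  Only
    the resulting control of Psi is recorded. *)
Let level_near u0 v0 e : `|v0| < tau -> 0 < e ->
  \forall p \near (Phi u0 v0, v0), `|p.2| < tau /\
    exists u, Phi u p.2 = p.1 /\ `|Psi u p.2 - Psi u0 v0| < e.
Proof.
move=> vt e0.
have /nbhs_ballP[r /= r0 hr] : \forall p \near (u0, v0), `|Psi u0 v0 - Psi p.1 p.2| < e.
  by apply: (cvgr_dist_lt (F := nbhs (u0, v0))) e0; exact: Psi_cont.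
pose d := r / 2; have d0 : 0 < d by rewrite divr_gt0.
have lo : Phi (u0 - d) v0 < Phi u0 v0 by apply: monotone_incr => //; lra.
have hi : Phi u0 v0 < Phi (u0 + d) v0 by apply: monotone_incr => //; lra.
pose m1 := (Phi (u0 - d) v0 + Phi u0 v0) / 2.
pose m2 := (Phi (u0 + d) v0 + Phi u0 v0) / 2.
have n1 : \forall c \near Phi u0 v0, m1 < c < m2.
  near=> c; apply/andP; split; near: c; [apply: lt_nbhsr|apply: lt_nbhsl];
    rewrite /m1 /m2; lra.
have cl : (fun v => Phi (u0 - d) v) @ v0 --> Phi (u0 - d) v0.
  exact: (@cont_v Phi (u0 - d) v0 (@Phi_cont _ _ vt)).
have cr : (fun v => Phi (u0 + d) v) @ v0 --> Phi (u0 + d) v0.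
  exact: (@cont_v Phi (u0 + d) v0 (@Phi_cont _ _ vt)).
have n2 : \forall v \near v0, [/\ `|v| < tau, ball v0 r v, Phi (u0 - d) v < m1 & m2 < Phi (u0 + d) v].
  near=> v; split; near: v.
  - exact: near_strip.
  - exact: nbhsx_ballx.
  - apply: (cvgr_lt _ cl); rewrite /m1; lra.
  - apply: (cvgr_gt _ cr); rewrite /m2; lra.
exists ([set c | m1 < c < m2], [set v | [/\ `|v| < tau, ball v0 r v, Phi (u0 - d) v < m1 & m2 < Phi (u0 + d) v]]) => //.
move=> [c v] /= [/andP[c1 c2] [vs vb p1 p2]]; split=> //.
have le_ud : u0 - d <= u0 + d by lra.
have cont : {within `[u0 - d, u0 + d], continuous (fun u => Phi u v)}.
  apply: continuous_in_subspaceT => u _; exact: (@cont_u Phi u v (@Phi_cont _ _ vs)).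
(* the level c lies strictly between the values of Phi(., v) at u0 - d and u0 + d *)
have [|u] := @IVT _ _ _ _ c le_ud cont.
  by rewrite ge_min le_max; apply/andP; split; apply/orP; [left|right]; apply: ltW; lra.
rewrite in_itv/= => /andP[u1 u2] uc; exists u; split=> //.
rewrite distrC; apply: (hr (u, v)); split => //=.
rewrite /ball/= ltr_norml; apply/andP; split; rewrite /d in u1 u2; lra.
Unshelve. all: by end_near. Qed.

(** On the level set of c, Psi becomes a continuous function of v, defined on an
    interval of heights: the intermediate value theorem applies. *)
Lemma image_section_interval c : is_interval (image_section c).
Proof.
suff main u1 v1 u2 v2 y : `|v1| < tau -> `|v2| < tau -> v1 < v2 ->
    Phi u1 v1 = c -> Phi u2 v2 = c ->
    Num.min (Psi u1 v1) (Psi u2 v2) <= y <= Num.max (Psi u1 v1) (Psi u2 v2) ->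
    image_section c y.
  move=> y1 y2 [u1 [v1 [s1 p1 q1]]] [u2 [v2 [s2 p2 q2]]] y /andP[y1y yy2].
  have [v12|v21|v12] := ltgtP v1 v2.
  - apply: (main u1 v1 u2 v2) => //.
    by rewrite q1 q2 ge_min le_max y1y yy2 orbT.
  - apply: (main u2 v2 u1 v1) => //.
    by rewrite q1 q2 ge_min le_max y1y yy2 orbT.
  - have u12 : u1 = u2 by apply: (@Phi_inj v1) => //; rewrite p1 v12 p2.
    exists u1, v1; split=> //; apply/eqP; rewrite q1 eq_le y1y /=.
    by rewrite (le_trans yy2)// -q1 -q2 u12 v12.
move=> s1 s2 v12 p1 p2 yb.
pose lev v : R := get [set u | Phi u v = c].
have levE v u : `|v| < tau -> Phi u v = c -> lev v = u.
  by move=> vs uc; apply: (Phi_inj vs); rewrite uc; exact: (@getI _ [set u | Phi u v = c] u).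
have strip v : v1 <= v <= v2 -> `|v| < tau.
  by move: s1 s2; rewrite !ltr_norml => /andP[a1 a2] /andP[b1 b2] /andP[d1 d2]; apply/andP; split; lra.
have levP v : v1 <= v <= v2 -> exists u, Phi u v = c.
  move=> /andP[]; rewrite le_eqVlt => /orP[/eqP <- _|h1]; first by exists u1.
  rewrite le_eqVlt => /orP[/eqP ->|h2]; first by exists u2.
  by apply: (level_convex s1 s2 _ p1 p2); rewrite h1.
have cont : {within `[v1, v2], continuous (fun v => Psi (lev v) v)}.
  apply: continuous_in_subspaceT => v; rewrite inE /= in_itv /= => vb.
  have [u uc] := levP v vb; have vs := strip v vb.
  rewrite /continuous_at (levE v u vs uc); apply/cvgrPdist_lt => e e0.
  have [[A B] /= [cA vB] AB] := level_near u vs e0.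
  apply: filterS vB => w wB; rewrite uc in cA.
  have [ws [u' [/= uc' h]]] := AB (c, w) (conj (nbhs_singleton cA) wB).
  by rewrite distrC (levE w u' ws uc').
have := @IVT _ _ _ _ y (ltW v12) cont.
rewrite (levE v1 u1 s1 p1) (levE v2 u2 s2 p2) => /(_ yb) [v].
rewrite in_itv /= => vb vy; have [u uc] := levP v vb; have vs := strip v vb.
by exists u, v; split=> //; rewrite -(levE v u vs uc).
Qed.

(** Since Psi is increasing along the level curve through (u0, v0), there are
    points of this curve below and above the image point.  They persist on the
    neighboring level curves, and [image_section_interval] fills the gap between
    them. *)
Lemma image_near u0 v0 : `|v0| < tau ->
  \forall p \near (Phi u0 v0, Psi u0 v0), image_section p.1 p.2.
Proof.
move=> vt; set c0 := Phi u0 v0; set y0 := Psi u0 v0.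
have [[A B] /= [cA vB] AB] := level_near u0 vt ltr01.
have /nbhs_ballP[r /= r0 rB] := vB.
have lev v : `|v0 - v| < r -> `|v| < tau /\ exists u, Phi u v = c0.
  move=> h; have [/= vs [u [uc _]]] := AB (c0, v) (conj (nbhs_singleton cA) (rB v h)).
  by split=> //; exists u.
pose d := r / 2; have d0 : 0 < d by rewrite divr_gt0.
have [s1 [u1 p1]] : `|v0 - d| < tau /\ exists u, Phi u (v0 - d) = c0.
  by apply: lev; rewrite opprB addrCA subrr addr0 gtr0_norm// /d; lra.
have [s2 [u2 p2]] : `|v0 + d| < tau /\ exists u, Phi u (v0 + d) = c0.
  by apply: lev; rewrite opprD addNKr normrN gtr0_norm// /d; lra.
have y1 : Psi u1 (v0 - d) < y0.
  have := @mono u1 (v0 - d) u0 v0 s1 vt; rewrite p1 subrr mul0r add0r.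
  rewrite opprB addrCA subrr addr0 pmulr_lgt0// subr_gt0; apply => -[_]; lra.
have y2 : y0 < Psi u2 (v0 + d).
  have := @mono u0 v0 u2 (v0 + d) vt s2; rewrite p2 subrr mul0r add0r.
  rewrite [v0 + d - v0]addrAC subrr add0r pmulr_lgt0// subr_gt0; apply => -[_]; lra.
pose e1 := (y0 - Psi u1 (v0 - d)) / 2.
pose e2 := (Psi u2 (v0 + d) - y0) / 2.
have e10 : 0 < e1 by rewrite /e1; lra.
have e20 : 0 < e2 by rewrite /e2; lra.
have [[A1 B1] /= [cA1 vB1] AB1] := level_near u1 s1 e10; rewrite p1 in cA1.
have [[A2 B2] /= [cA2 vB2] AB2] := level_near u2 s2 e20; rewrite p2 in cA2.
exists (A1 `&` A2, [set y | y0 - e1 < y < y0 + e2]) => /=.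
  split; first exact: filterI.
  near=> y; apply/andP; split; near: y; [apply: lt_nbhsr|apply: lt_nbhsl]; lra.
move=> [c y] /= [[c1 c2] /andP[ly yl]].
have [_ [w1 [/= q1 h1]]] := AB1 (c, v0 - d) (conj c1 (nbhs_singleton vB1)).
have [_ [w2 [/= q2 h2]]] := AB2 (c, v0 + d) (conj c2 (nbhs_singleton vB2)).
have J1 : image_section c (Psi w1 (v0 - d)) by exists w1, (v0 - d).
have J2 : image_section c (Psi w2 (v0 + d)) by exists w2, (v0 + d).
apply: (image_section_interval J1 J2).
move: h1 h2; rewrite !ltr_norml /e1 /e2 in ly yl * => /andP[a1 a2] /andP[b1 b2].
apply/andP; split; lra.
Unshelve. all: by end_near. Qed.

End LevelCurves.

(** * Sets whose vertical sections are intervals *)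

Section VerticalSections.
Variable R : realType.
Implicit Types (z w : R[i]) (c y : R) (A : set R[i]).

Definition vertical_section A c : set R := [set y | A (c +i* y)].

Lemma vertical_line_cvg c y : (fun t : R => c +i* t) @ y --> c +i* y.
Proof. by apply: cvg_complex; [exact: cvg_cst|exact: cvg_id]. Qed.

Lemma connected_vertical_section A c : is_interval (vertical_section A c) ->
  connected (vertical_line c `&` A).
Proof.
move=> /connected_intervalP h.
have -> : vertical_line c `&` A = (fun t : R => c +i* t) @` vertical_section A c.
  apply/seteqP; split=> [[x y] [/= <- Axy]|_ [y Ay <-]] //; by exists y.
apply: connected_continuous_connected h _.
by apply: continuous_subspaceT => y; exact: vertical_line_cvg.
Qed.

Lemma half_line_up c y w :
  half_line (c +i* y) 'i%C w <-> complex.Re w = c /\ y <= complex.Im w.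
Proof.
rewrite /half_line /=; split.
  by move=> [t t0 ->]; simpc => /=; split=> //; rewrite lerDl.
case: w => x v /= [-> yv]; exists (v - y); first by rewrite subr_ge0.
by simpc; congr (_ +i* _); ring.
Qed.

Lemma half_line_down c y w :
  half_line (c +i* y) (- 'i%C) w <-> complex.Re w = c /\ complex.Im w <= y.
Proof.
rewrite /half_line /=; split.
  by move=> [t t0 ->]; simpc => /=; split=> //; rewrite gerBl.
case: w => x v /= [-> yv]; exists (y - v); first by rewrite subr_ge0.
by simpc; congr (_ +i* _); ring.
Qed.

(** Origin of the upward half-line of the complement on the line of abscissa c.
    A line missed by A is cut at height 0 into two opposite half-lines; a
    section that is unbounded above has no such origin. *)
Definition top_end A c y := vertical_section A c = set0 /\ y = 0 \/
  [/\ vertical_section A c !=set0, has_ubound (vertical_section A c) & y = sup (vertical_section A c)].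

Definition bottom_end A c y := vertical_section A c = set0 /\ y = 0 \/
  [/\ vertical_section A c !=set0, has_lbound (vertical_section A c) & y = inf (vertical_section A c)].

Definition complementary_half_lines A : set (R[i] * R[i]) :=
  [set l | exists c y, l.1 = c +i* y /\
    (l.2 = 'i%C /\ top_end A c y \/ l.2 = - 'i%C /\ bottom_end A c y)].

Lemma top_end_uniq A c y y' : top_end A c y -> top_end A c y' -> y = y'.
Proof.
move=> [[A0 ->]|[A0 _ ->]] [[A0' ->]|[A0' _ ->]] //.
  by move: A0'; rewrite A0 => -[].
by move: A0; rewrite A0' => -[].
Qed.

Lemma bottom_end_uniq A c y y' : bottom_end A c y -> bottom_end A c y' -> y = y'.
Proof.
move=> [[A0 ->]|[A0 _ ->]] [[A0' ->]|[A0' _ ->]] //.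
  by move: A0'; rewrite A0 => -[].
by move: A0; rewrite A0' => -[].
Qed.

Lemma bottom_le_top A c y y' : bottom_end A c y -> top_end A c y' -> y <= y'.
Proof.
move=> [[A0 ->]|[A0 lb ->]] [[A0' ->]|[A0' ub ->]] //.
  by move: A0'; rewrite A0 => -[].
  by move: A0; rewrite A0' => -[].
have [x Ax] := A0.
by rewrite (@le_trans _ _ x)//; [exact: ge_inf|exact: ub_le_sup].
Qed.

Lemma vertical_section_nbhs A c y : open A -> vertical_section A c y -> nbhs y (vertical_section A c).
Proof.
move=> Ao Ay; apply: (@vertical_line_cvg c y); exact: open_nbhs_nbhs.
Qed.

(** An open section does not contain its supremum. *)
Lemma top_end_notin A c y v : open A -> top_end A c y -> y <= v -> ~ vertical_section A c v.
Proof.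
move=> Ao [[A0 _] _|[A0 ub ->] sv Av]; first by rewrite A0.
have /nbhs_ballP[r /= r0 rA] := vertical_section_nbhs Ao Av.
have /ub_le_sup : vertical_section A c (v + r / 2).
  by apply: rA; rewrite /ball/= opprD addNKr normrN gtr0_norm ?divr_gt0//; lra.
by move=> /(_ ub); lra.
Qed.

Lemma bottom_end_notin A c y v : open A -> bottom_end A c y -> v <= y -> ~ vertical_section A c v.
Proof.
move=> Ao [[A0 _] _|[A0 lb ->] sv Av]; first by rewrite A0.
have /nbhs_ballP[r /= r0 rA] := vertical_section_nbhs Ao Av.
have /ge_inf : vertical_section A c (v - r / 2).
  by apply: rA; rewrite /ball/= opprB addrCA subrr addr0 gtr0_norm ?divr_gt0//; lra.
by move=> /(_ lb); lra.
Qed.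

(** A point of the complement lies above or below the whole section of its
    vertical line, the section being an interval.  Half-lines on the same vertical
    line overlap at most when they are opposite, and then only in a common origin,
    by [bottom_le_top]. *)
Lemma vertically_convex_close_to_convex A : open A -> connected A ->
  (forall c, is_interval (vertical_section A c)) -> close_to_convex_domain A.
Proof.
move=> Ao Ac Ai; split=> //; exists (complementary_half_lines A); split.
- move=> l [c [y [_ [[-> _]|[-> _]]]]]; rewrite /=.
    by rewrite expr0n expr1n add0r sqrtr1.
  by rewrite oppr0 expr0n sqrrN expr1n add0r sqrtr1.
- apply/seteqP; split=> [[c v] nA|[c v] [l [c' [y [l1 H]]]]]; last first.
    rewrite l1; case: H => -[-> e].
      by move=> /half_line_up[/= -> yv]; exact: (top_end_notin Ao e yv).
    by move=> /half_line_down[/= -> yv]; exact: (bottom_end_notin Ao e yv).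
  have [A0|/set0P [j Aj]] := eqVneq (vertical_section A c) set0.
    have [v0|v0] := leP 0 v.
      exists (c +i* 0, 'i%C); last exact/half_line_up.
      by exists c, 0; split=> //; left; split=> //; left.
    exists (c +i* 0, - 'i%C); last by apply/half_line_down; split=> //; exact: ltW.
    by exists c, 0; split=> //; right; split=> //; left.
  have jv : j != v by apply/eqP => jv; apply: nA; rewrite -jv.
  have [jv'|vj|jv'] := ltgtP j v; last by rewrite jv' eqxx in jv.
    have ub : ubound (vertical_section A c) v.
      move=> x Ax; rewrite leNgt; apply/negP => vx; apply: nA.
      by apply: (Ai c j x) => //; rewrite (ltW jv') (ltW vx).
    exists (c +i* sup (vertical_section A c), 'i%C).
      exists c, (sup (vertical_section A c)); split=> //; left; split=> //; right.
      by split=> //; [exists j|exists v].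
    by apply/half_line_up; split=> //; apply: ge_sup => //; exists j.
  have lb : lbound (vertical_section A c) v.
    move=> x Ax; rewrite leNgt; apply/negP => vx; apply: nA.
    by apply: (Ai c x j) => //; rewrite (ltW vj) (ltW vx).
  exists (c +i* inf (vertical_section A c), - 'i%C).
    exists c, (inf (vertical_section A c)); split=> //; right; split=> //; right.
    by split=> //; [exists j|exists v].
  by apply/half_line_down; split=> //; apply: lb_le_inf => //; exists j.
- move=> [p d] [p2 d2] [c [y [/= -> H]]] [c2 [y2 [/= -> H2]]] ne [x v] [] /=.
  case: H => -[dE e]; case: H2 => -[dE2 e2]; rewrite dE dE2 in ne *.
  + move=> /half_line_up[/= xc _] /half_line_up[/= xc2 _]; case: ne.
    by rewrite -xc -xc2 in e e2 *; rewrite (top_end_uniq e e2).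
  + move=> /half_line_up[/= xc yv] /half_line_down[/= xc2 vy].
    rewrite -xc -xc2 in e e2 *; left; congr (_ +i* _); apply/eqP.
    by rewrite eq_le yv (le_trans vy)//; exact: bottom_le_top e2 e.
  + move=> /half_line_down[/= xc vy] /half_line_up[/= xc2 yv].
    rewrite -xc -xc2 in e e2 *; left; congr (_ +i* _); apply/eqP.
    by rewrite eq_le vy (le_trans _ yv)//; exact: bottom_le_top e e2.
  + move=> /half_line_down[/= xc _] /half_line_down[/= xc2 _]; case: ne.
    by rewrite -xc -xc2 in e e2 *; rewrite (bottom_end_uniq e e2).
Qed.

End VerticalSections.

(** * Harmonic mappings with |Q| < Re P in the strip *)

Section StripMappings.
Variable R : realType.
Implicit Types (z w : R[i]) (u v e s t : R).

Definition strip_Re (f : R[i] -> R[i]) u v : R := complex.Re (f (strip_map u v)).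
Definition strip_Im (f : R[i] -> R[i]) u v : R := complex.Im (f (strip_map u v)).

Variables (f P Q : R[i] -> R[i]).
(* f o strip_map has Wirtinger derivatives P o strip_map and conj (Q o strip_map). *)
Hypothesis f_velocity : forall u v (du dv t : R), in_strip (v + t * dv) ->
  velocity (fun s => f (strip_map (u + s * du) (v + s * dv))) t
   ((du +i* dv) * P (strip_map (u + t * du) (v + t * dv)) +
    conjc ((du +i* dv) * Q (strip_map (u + t * du) (v + t * dv)))).
Hypothesis PQ : forall z, unit_disk z -> normc (Q z) < complex.Re (P z).
Hypothesis f_cont : forall z, unit_disk z -> {for z, continuous f}.
Hypothesis W_unif : forall e, 0 < e -> exists2 r : R, 0 < r &
  forall z w, unit_disk z -> unit_disk w ->
    normc (z - w) < r -> normc ((P z + Q z) - (P w + Q w)) <= e.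

Local Notation Phi := (strip_Re f).
Local Notation Psi := (strip_Im f).

Let strip_seg v v' t : in_strip v -> in_strip v' -> 0 <= t <= 1 ->
  in_strip (v + t * (v' - v)).
Proof.
rewrite /in_strip !ltr_norml => /andP[v1 v2] /andP[v3 v4] /andP[t0 t1].
have [vv|/ltW vv] := leP v v'.
  have h1 : 0 <= t * (v' - v) by rewrite mulr_ge0// subr_ge0.
  have h2 : t * (v' - v) <= v' - v by rewrite ler_piMl// subr_ge0.
  by apply/andP; split; lra.
have h1 : 0 <= t * (v - v') by rewrite mulr_ge0// subr_ge0.
have h2 : t * (v - v') <= v - v' by rewrite ler_piMl// subr_ge0.
by apply/andP; split; lra.
Qed.

(** Mean value theorem on the segment from (u, v) to (u', v') of direction d: the
    scalar product is an increment of Re (conj d * f), whose derivative is at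
    least |d|^2 (Re P - |Q|). *)
Lemma strip_monotone u v u' v' : in_strip v -> in_strip v' -> (u, v) <> (u', v') ->
  0 < (Phi u' v' - Phi u v) * (u' - u) + (Psi u' v' - Psi u v) * (v' - v).
Proof.
move=> vs vs' ne; set du := u' - u; set dv := v' - v; set d := du +i* dv.
have d0 : 0 < normc d ^+ 2.
  rewrite sqr_normcE /= lt_neqAle addr_ge0 ?sqr_ge0// andbT eq_sym.
  rewrite paddr_eq0 ?sqr_ge0// !sqrf_eq0 !subr_eq0; apply/negP.
  by move=> /andP[/eqP h1 /eqP h2]; apply: ne; rewrite h1 h2.
pose F t := f (strip_map (u + t * du) (v + t * dv)).
pose T t := strip_map (u + t * du) (v + t * dv).
pose D t := complex.Re (conjc d * (d * P (T t) + conjc (d * Q (T t)))).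
have seg t : 0 <= t <= 1 -> in_strip (v + t * dv) by exact: strip_seg.
have der t : 0 <= t <= 1 -> is_derive t 1 (fun s => complex.Re (conjc d * F s)) (D t).
  by move=> t01; apply: velocity_Re; apply: f_velocity; exact: seg.
have [|||t t01] := @MVT R (fun s => complex.Re (conjc d * F s)) D 0 1.
- exact: ltr01.
- by move=> t; rewrite in_itv/= => /andP[t0 t1]; apply: der; rewrite !ltW.
- apply: derivable_within_continuous => t; rewrite in_itv/= => /der t01.
  exact: ex_derive.
rewrite subr0 mulr1 -ReB -mulrBr /F !mul1r !mul0r !addr0 /du /dv !subrKC.
have Dpos : 0 < D t.
  move: t01; rewrite in_itv/= => /andP[t0 t1].
  have TD : unit_disk (T t) by apply: strip_map_disk; apply: seg; rewrite !ltW.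
  have := PQ TD; rewrite /D; move: (P (T t)) (Q (T t)) => p q pq.
  have -> : complex.Re (conjc d * (d * p + conjc (d * q))) =
      normc d ^+ 2 * complex.Re p + complex.Re (conjc (d * d * q)).
    rewrite sqr_normcE; case: (d) p q {pq} => [d1 d2] [p1 p2] [q1 q2] /=; ring.
  have := Re_le_normc (conjc (d * d * q)).
  rewrite normc_conj !Normc.normcM -expr2 ler_norml => /andP[h _].
  by nra.
move=> h; move: Dpos; rewrite -h /strip_Re /strip_Im -/du -/dv.
rewrite /d; case: (f _) (f _) => [a b] [a' b'] /= H.
by apply: (lt_le_trans H); rewrite le_eqVlt; apply/orP; left; apply/eqP; ring.
Qed.

Lemma f2_univalent : univalent f.
Proof.
move=> z w; rewrite !inE => /strip_map_surj[u [v [vs <-]]] /strip_map_surj[u' [v' [vs' <-]]] fE.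
have [[-> ->]//|ne] := pselect ((u, v) = (u', v')).
by have := strip_monotone vs vs' ne; rewrite /strip_Re /strip_Im fE !subrr !mul0r addr0 ltxx.
Qed.

(** P + Q oscillates little on vertical segments far from the origin, because
    their images cluster at 1 or at -1. *)
Let W_far e : 0 < e -> exists U : R, forall u v v', U <= `|u| ->
  in_strip v -> in_strip v' ->
  normc ((P (strip_map u v) + Q (strip_map u v)) -
         (P (strip_map u v') + Q (strip_map u v'))) <= e.
Proof.
move=> /W_unif[r r0 hr]; exists (2 / r) => u v v' Uu vs vs'.
apply: hr; [exact: strip_map_disk|exact: strip_map_disk|].
have ur : 4 * expR (- (2 * `|u|)) < r.
  rewrite expRN ltr_pdivrMr ?expR_gt0// (@lt_le_trans _ _ (r * (1 + 2 * `|u|)))//.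
    by move: Uu; rewrite ler_pdivrMr// => Uu; rewrite mulrDr; lra.
  by rewrite ler_pM2l// expR_ge1Dx.
apply: le_lt_trans ur; have [u0|u0] := leP 0 u.
  rewrite (_ : _ - _ = (strip_map u v - 1) - (strip_map u v' - 1)); last by ring.
  rewrite (le_trans (ler_normcD _ _))// normc_opp.
  rewrite ger0_norm//;   have := strip_map_near1 u vs; have := strip_map_near1 u vs'; lra.
rewrite (_ : _ - _ = (strip_map u v + 1) - (strip_map u v' + 1)); last by ring.
rewrite (le_trans (ler_normcD _ _))// normc_opp ltr0_norm// mulrN opprK.
have := strip_map_nearN1 u vs; have := strip_map_nearN1 u vs'; lra.
Qed.

(** The vertical derivative of Phi is - Im (P + Q), so Phi stays close to its
    chord where P + Q oscillates little.  Mean value points a in [0, t] and b in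
    [t, 1] turn the gap into t (1 - t) (D a - D b). *)
Let Phi_affine u v1 v2 t e : in_strip v1 -> in_strip v2 -> 0 < t < 1 ->
  (forall v v', in_strip v -> in_strip v' ->
   normc ((P (strip_map u v) + Q (strip_map u v)) -
         (P (strip_map u v') + Q (strip_map u v'))) <= e) ->
  `|Phi u (v1 + t * (v2 - v1)) - ((1 - t) * Phi u v1 + t * Phi u v2)| <= `|v2 - v1| * e.
Proof.
move=> s1 s2 /andP[t0 t1] We; set dv := v2 - v1.
pose W v := P (strip_map u v) + Q (strip_map u v).
pose X s := Phi u (v1 + s * dv).
pose D s := complex.Re ((0 +i* dv) * W (v1 + s * dv)).
have seg s : 0 <= s <= 1 -> in_strip (v1 + s * dv) by exact: strip_seg.
have der s : 0 <= s <= 1 -> is_derive s 1 X (D s).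
  move=> s01; have := velocity_Re 1 (@f_velocity u v1 0 dv s (seg s s01)).
  rewrite (_ : complex.Re _ = D s).
    congr is_derive; apply/funext => s'; by rewrite mul1r mulr0 addr0.
  rewrite /D /W mulr0 addr0; move: (P _) (Q _) => [p1 p2] [q1 q2] /=; ring.
have mvt (x y : R) : 0 <= x -> x < y -> y <= 1 ->
    exists2 s, 0 <= s <= 1 & X y - X x = D s * (y - x).
  move=> x0 xy y1; have [|||s] := @MVT R X D x y.
  - exact: xy.
  - by move=> s; rewrite in_itv/= => /andP[s0 s1']; apply: der; apply/andP; split; lra.
  - apply: derivable_within_continuous => s; rewrite in_itv/= => /andP[xs sy].
    have [] : is_derive s 1 X (D s) by apply: der; apply/andP; split; lra.
    by [].
  rewrite in_itv/= => /andP[xs sy] h; exists s => //.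
  by apply/andP; split; lra.
have [a a01 ha] := mvt 0 t (lexx 0) t0 (ltW t1).
have [b b01 hb] := mvt t 1 (ltW t0) t1 (lexx 1).
have -> : Phi u v1 = X 0 by rewrite /X mul0r addr0.
have -> : Phi u v2 = X 1 by rewrite /X mul1r /dv addrCA subrr addr0.
rewrite -/(X t) (_ : _ - _ = t * (1 - t) * (D a - D b)); last first.
  transitivity ((1 - t) * (X t - X 0) - t * (X 1 - X t)); first by ring.
  by rewrite ha hb; ring.
have -> : D a - D b = complex.Re ((0 +i* dv) * (W (v1 + a * dv) - W (v1 + b * dv))).
  by rewrite mulrBr ReB.
rewrite normrM (@le_trans _ _ (1 * (`|dv| * e)))//; last by rewrite mul1r.
rewrite ler_pM//.
  by rewrite ger0_norm ?mulr_ge0//; nra.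
rewrite (le_trans (Re_le_normc _))// Normc.normcM ler_pM ?normc_ge0//; last first.
  by apply: We; exact: seg.
by rewrite /= expr0n add0r sqrtr_sqr.
Qed.

Let Phi_incr v u u' : in_strip v -> u < u' -> Phi u v < Phi u' v.
Proof. exact: (monotone_incr strip_monotone). Qed.

Let Phi_cont u v : in_strip v ->
  {for (u, v), continuous (fun p : R * R => Phi p.1 p.2)}.
Proof.
move=> vs; have h := cvg_comp _ _ (strip_map_continuous (u := u) vs)
  (f_cont (strip_map_disk u vs)).
exact: (cvg_comp _ _ h (@Re_continuous R _)).
Qed.

Let Psi_cont u v : in_strip v ->
  {for (u, v), continuous (fun p : R * R => Psi p.1 p.2)}.
Proof.
move=> vs; have h := cvg_comp _ _ (strip_map_continuous (u := u) vs)
  (f_cont (strip_map_disk u vs)).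
exact: (cvg_comp _ _ h (@Im_continuous R _)).
Qed.

Let Phi_cont_u v : in_strip v -> continuous (fun u => Phi u v).
Proof.
move=> vs u; have h : (fun x : R => (x, v)) @ nbhs u --> (u, v).
  exact: (cvg_pair cvg_id (cvg_cst v)).
exact: (cvg_comp _ _ h (@Phi_cont u v vs)).
Qed.

(** For large u, Phi exceeds c at the heights v1 and v2 by a fixed amount m, and it
    is within m / 2 of its chord in between, so it exceeds c at the height v; the
    same holds with the signs reversed near -oo. *)
Lemma strip_level_convex c u1 v1 u2 v2 v : in_strip v1 -> in_strip v2 ->
  v1 < v < v2 -> Phi u1 v1 = c -> Phi u2 v2 = c -> exists u, Phi u v = c.
Proof.
move=> s1 s2 /andP[v1v vv2] p1 p2.
have v12 : 0 < v2 - v1 by lra.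
pose t := (v - v1) / (v2 - v1).
have vE : v = v1 + t * (v2 - v1) by rewrite /t divfK ?gt_eqF//; ring.
have t01 : 0 < t < 1.
  by apply/andP; split; [rewrite divr_gt0//; lra|rewrite ltr_pdivrMr// mul1r; lra].
have vs : in_strip v by rewrite vE; apply: strip_seg => //; rewrite !ltW//; case/andP: t01.
have [u' hu'] : exists u', c < Phi u' v.
  have q1 : c < Phi (u1 + 1) v1 by rewrite -p1; apply: Phi_incr => //; lra.
  have q2 : c < Phi (u2 + 1) v2 by rewrite -p2; apply: Phi_incr => //; lra.
  (* the gap above c at the abscissas u1 + 1 and u2 + 1; it only grows further right, as Phi increases with u *)
  pose m := Num.min (Phi (u1 + 1) v1) (Phi (u2 + 1) v2) - c.
  have m0 : 0 < m by rewrite subr_gt0 lt_min q1 q2.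
  have [U hU] := W_far (divr_gt0 (divr_gt0 m0 (ltr0n R 2)) v12).
  pose u := `|U| + `|u1| + `|u2| + 1; exists u.
  have := ler_norm U; have := ler_norm u1; have := ler_norm u2 => l1 l2 l3.
  have := normr_ge0 U; have := normr_ge0 u1; have := normr_ge0 u2 => l4 l5 l6.
  have uU : U <= `|u| by apply: (le_trans _ (ler_norm u)); rewrite /u; lra.
  have := Phi_affine s1 s2 t01 (fun v v' => @hU u v v' uU); rewrite -vE.
  rewrite (gtr0_norm v12) [(v2 - v1) * (_ / _)]mulrC divfK ?gt_eqF// ler_norml => /andP[h _].
  have r1 : Phi (u1 + 1) v1 <= Phi u v1.
    have : u1 + 1 <= u by rewrite /u; lra.
    by rewrite le_eqVlt => /orP[/eqP <-//|/(Phi_incr s1)/ltW].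
  have r2 : Phi (u2 + 1) v2 <= Phi u v2.
    have : u2 + 1 <= u by rewrite /u; lra.
    by rewrite le_eqVlt => /orP[/eqP <-//|/(Phi_incr s2)/ltW].
  have m1 : m + c <= Phi u v1 by rewrite /m subrK (le_trans _ r1)// ge_min lexx.
  have m2 : m + c <= Phi u v2 by rewrite /m subrK (le_trans _ r2)// ge_min lexx orbT.
  move: t01 => /andP[t0 t1]; nra.
have [u hu] : exists u, Phi u v < c.
  have q1 : Phi (u1 - 1) v1 < c by rewrite -p1; apply: Phi_incr => //; lra.
  have q2 : Phi (u2 - 1) v2 < c by rewrite -p2; apply: Phi_incr => //; lra.
  pose m := c - Num.max (Phi (u1 - 1) v1) (Phi (u2 - 1) v2).
  have m0 : 0 < m by rewrite subr_gt0 gt_max q1 q2.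
  have [U hU] := W_far (divr_gt0 (divr_gt0 m0 (ltr0n R 2)) v12).
  pose u := - (`|U| + `|u1| + `|u2| + 1); exists u.
  have := ler_norm U; have := ler_norm (- u1); have := ler_norm (- u2).
  rewrite !normrN => l1 l2 l3.
  have := normr_ge0 U; have := normr_ge0 u1; have := normr_ge0 u2 => l4 l5 l6.
  have uU : U <= `|u| by rewrite normrN; apply: (le_trans _ (ler_norm _)); lra.
  have := Phi_affine s1 s2 t01 (fun v v' => @hU u v v' uU); rewrite -vE.
  rewrite (gtr0_norm v12) [(v2 - v1) * (_ / _)]mulrC divfK ?gt_eqF// ler_norml => /andP[_ h].
  have r1 : Phi u v1 <= Phi (u1 - 1) v1.
    have : u <= u1 - 1 by rewrite /u; lra.
    by rewrite le_eqVlt => /orP[/eqP <-//|/(Phi_incr s1)/ltW].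
  have r2 : Phi u v2 <= Phi (u2 - 1) v2.
    have : u <= u2 - 1 by rewrite /u; lra.
    by rewrite le_eqVlt => /orP[/eqP <-//|/(Phi_incr s2)/ltW].
  have m1 : Phi u v1 <= c - m by rewrite /m subKr (le_trans r1)// le_max lexx.
  have m2 : Phi u v2 <= c - m by rewrite /m subKr (le_trans r2)// le_max lexx orbT.
  move: t01 => /andP[t0 t1]; nra.
have uu' : u <= u'.
  rewrite leNgt; apply/negP => /(Phi_incr vs); lra.
have [||w _ wc] := @IVT R (fun u => Phi u v) u u' c uu'.
- by apply: continuous_subspaceT; exact: Phi_cont_u.
- by rewrite ge_min le_max (ltW hu) (ltW hu') orbT.
by exists w.
Qed.

Lemma image_vertical_section c :
  vertical_section (f @` unit_disk) c = image_section (pi / 4) Phi Psi c.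
Proof.
apply/seteqP; split=> y /=.
  move=> [z /strip_map_surj[u [v [vs <-]]] fE].
  by exists u, v; split=> //; rewrite /strip_Re /strip_Im fE.
move=> [u [v [vs <- <-]]]; exists (strip_map u v); first exact: strip_map_disk.
by rewrite /strip_Re /strip_Im; case: (f _).
Qed.

Lemma image_vertical_section_interval c : is_interval (vertical_section (f @` unit_disk) c).
Proof.
rewrite image_vertical_section; apply: image_section_interval.
- exact: Phi_cont.
- exact: Psi_cont.
- exact: strip_monotone.
- exact: strip_level_convex.
Qed.

Lemma image_disk_open : open (f @` unit_disk).
Proof.
rewrite openE => _ [_ /strip_map_surj[u [v [vs <-]]] <-].
have h := image_near Phi_cont Psi_cont strip_monotone strip_level_convex (v0 := v) u vs.
set w := f _.
have c : (fun w => (complex.Re w, complex.Im w)) @ nbhs w --> (complex.Re w, complex.Im w).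
  exact: (cvg_pair (@Re_continuous R w) (@Im_continuous R w)).
apply: (@filterS _ (nbhs w) (nbhs_filter w) _ _ _ (c _ h)) => -[x y] /=.
by rewrite -image_vertical_section.
Qed.

(** The disk is a union of segments through 0. *)
Lemma image_disk_connected : connected (f @` unit_disk).
Proof.
apply: connected_continuous_connected; last first.
  by apply: continuous_in_subspaceT => z; rewrite inE; exact: f_cont.
have -> : @unit_disk R = \bigcup_(z in unit_disk) ((fun t : R => t%:C * z) @` `[0, 1]).
  apply/seteqP; split=> [z zD|_ [z zD [t /= t01 <-]]].
    by exists z => //; exists 1; rewrite ?mul1r//= in_itv /= ler01 lexx.
  move: t01; rewrite /unit_disk /= in_itv /= => /andP[t0 t1].
  rewrite Normc.normcM normc_real ger0_norm//.
  by rewrite (le_lt_trans _ zD)// ler_piMl// normc_ge0.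
apply: bigcup_connected.
  exists 0 => z _; exists 0; last by rewrite mul0r.
  by rewrite /= in_itv /= lexx ler01.
move=> z _; apply: connected_continuous_connected.
  by apply/connected_intervalP; exact: interval_is_interval.
apply: continuous_subspaceT => t.
apply: (@velocity_continuous _ (fun t : R => t%:C * z) t z) => e e0.
near=> s; have -> : s%:C * z - t%:C * z - (s - t)%:C * z = 0.
  by rewrite rmorphB /=; ring.
by rewrite Normc.normc0 mulr_ge0// ltW.
Unshelve. all: by end_near. Qed.

Lemma f2_convex_in_vertical_direction : convex_in_vertical_direction f.
Proof.
split; first exact: f2_univalent.
move=> c; exact: connected_vertical_section (@image_vertical_section_interval c).
Qed.

Lemma f2_close_to_convex : close_to_convex f.
Proof.
split; first exact: f2_univalent.
apply: vertically_convex_close_to_convex.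
- exact: image_disk_open.
- exact: image_disk_connected.
- exact: image_vertical_section_interval.
Qed.

End StripMappings.

(** * From the coefficient condition to the mapping properties *)

Section Coefficients.
Variable R : realType.

Lemma weighted_sum_bound (a : nat -> R[i]) (B : R) :
  (forall n, \sum_(1 <= i < n) normc (weighted_coef a i) <= B) ->
  forall n, \sum_(0 <= i < n) normc (weighted_coef a i) <= normc (a 1%N) + B.
Proof.
move=> aB n; have B0 : 0 <= B by have := aB 0%N; rewrite big_geq.
case: n => [|n]; first by rewrite big_geq// addr_ge0// normc_ge0.
by rewrite big_ltn// lerD// /weighted_coef /= mul0r subr0 mul1r.
Qed.

Lemma weighted_derivative (c : nat -> R[i]) (k : R[i] -> R[i]) (K : R) :
  (forall n, \sum_(0 <= i < n) normc (weighted_coef c i) <= K) ->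
  (forall z, unit_disk z -> series (fun n => c n * z ^+ n) @ \oo --> k z) ->
  exists k' : R[i] -> R[i], forall z, unit_disk z -> has_wirtinger k z (k' z) 0 /\
    series (fun n => weighted_coef c n * z ^+ n) @ \oo --> (1 - z ^+ 2) * k' z.
Proof.
move=> cK kE.
have H z : exists d : R[i], unit_disk z -> has_wirtinger k z d 0 /\
    series (fun n => weighted_coef c n * z ^+ n) @ \oo --> (1 - z ^+ 2) * d.
  have [zD|nzD] := pselect (unit_disk z); last by exists 0.
  have [d dE dd] := power_series_has_wirtinger (deriv_coef_le cK) kE zD.
  by exists d => _; split; [exact: dd|exact: weighted_series_cvg dE].
have [k' k'E] := boolp.choice H.
by exists k'.
Qed.

(** |p - 1| + |q| <= |b_1| + |z| (1 - |b_1|) < 1: the coefficients of positive index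
    carry a factor |z|, which makes the inequality strict even if the
    coefficient bound is attained. *)
Lemma weighted_dominated (a b : nat -> R[i]) (z p q : R[i]) :
  a 1%N = 1 -> normc (b 1%N) < 1 -> unit_disk z ->
  (forall N M, \sum_(1 <= i < N) normc (weighted_coef a i) +
    \sum_(1 <= i < M) normc (weighted_coef b i) <= 1 - normc (b 1%N)) ->
  series (fun n => weighted_coef a n * z ^+ n) @ \oo --> p ->
  series (fun n => weighted_coef b n * z ^+ n) @ \oo --> q ->
  normc q < complex.Re p.
Proof.
move=> a1 b1 zD ab ap bq; have z1 : normc z < 1 := zD.
have z0 : 0 <= normc z := normc_ge0 z.
have tail (c : nat -> R[i]) n : normc (series (fun n => weighted_coef c n * z ^+ n) n.+1 - c 1%N)
    <= normc z * \sum_(1 <= i < n.+1) normc (weighted_coef c i).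
  rewrite /series/= big_ltn// expr0 mulr1 {1}/weighted_coef/= mul0r subr0 mul1r.
  rewrite [_ + _ - _]addrAC subrr add0r (le_trans (ler_normc_sum _ _ _))//.
  rewrite mulr_sumr ler_sum_nat// => i /andP[i1 _].
  rewrite Normc.normcM normcX mulrC ler_wpM2r ?normc_ge0//.
  by rewrite -[leRHS]expr1 ler_wiXn2l// ltW.
pose B := normc (b 1%N) + normc z * (1 - normc (b 1%N)).
have sumB n m : normc (series (fun n => weighted_coef a n * z ^+ n) n.+1 - 1) +
    normc (series (fun n => weighted_coef b n * z ^+ n) m.+1) <= B.
  have := tail a n; have := tail b m; rewrite a1 => hb ha.
  have := ler_normcD (series (fun n => weighted_coef b n * z ^+ n) m.+1 - b 1%N) (b 1%N).
  rewrite subrK => hc; have := ler_wpM2l z0 (ab n.+1 m.+1).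
  by rewrite mulrDr /B => hd; lra.
have one : (fun _ : nat => 1 : R[i]) @ \oo --> (1 : R[i]) by exact: cvg_cst.
have pm m : normc (p - 1) <= B - normc (series (fun n => weighted_coef b n * z ^+ n) m.+1).
  apply: (cvg_normc_le (cvgC_B (cvgC_shiftS ap) one)).
  by apply: nearW => n; rewrite lerBrDr.
have pq : normc q <= B - normc (p - 1).
  apply: (cvg_normc_le (cvgC_shiftS bq)).
  by apply: nearW => m; have := pm m; lra.
have hp : 1 - normc (p - 1) <= complex.Re p.
  have := Re_le_normc (p - 1); rewrite ReB /= ler_norml => /andP[h _]; lra.
suff : B < 1 by lra.
rewrite /B; have : normc z * (1 - normc (b 1%N)) < 1 * (1 - normc (b 1%N)).
  by rewrite ltr_pM2r// subr_gt0.
lra.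
Qed.

End Coefficients.

Unset Implicit Arguments.

Theorem lemma2 (R : realType) (f h g : R[i] -> R[i]) (a b : nat -> R[i])
  (fH : class_H f)
  (hA : analytic_on unit_disk h) (gA : analytic_on unit_disk g)
  (fE : forall z, unit_disk z -> f z = h z + conjc (g z))
  (a0 : a 0%N = 0) (a1 : a 1%N = 1) (b0 : b 0%N = 0)
  (hE : forall z, unit_disk z -> series (fun n => a n * z ^+ n) @ \oo --> h z)
  (gE : forall z, unit_disk z -> series (fun n => b n * z ^+ n) @ \oo --> g z)
  (b1_lt1 : normc (b 1%N) < 1)
  (coef_le :
    (\sum_(1 <= n <oo)
        (normc (n.+1%:R * a n.+1 - n.-1%:R * a n.-1))%:E
     + \sum_(1 <= n <oo)
        (normc (n.+1%:R * b n.+1 - n.-1%:R * b n.-1))%:E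
     <= (1 - normc (b 1%N))%:E)%E) :
  [/\ class_F2 f, convex_in_vertical_direction f & close_to_convex f].
Proof.
have ab N M : \sum_(1 <= i < N) normc (weighted_coef a i) +
    \sum_(1 <= i < M) normc (weighted_coef b i) <= 1 - normc (b 1%N).
  rewrite -lee_fin EFinD -!sumEFin (le_trans _ coef_le)//.
  by apply: leeD; apply: nneseries_lim_ge => n _ _; rewrite lee_fin normc_ge0.
have aB n : \sum_(1 <= i < n) normc (weighted_coef a i) <= 1 - normc (b 1%N).
  by have := ab n 0%N; rewrite [X in _ + X]big_geq// addr0.
have bB n : \sum_(1 <= i < n) normc (weighted_coef b i) <= 1 - normc (b 1%N).
  by have := ab 0%N n; rewrite [X in X + _]big_geq// add0r.
have aS := weighted_sum_bound aB; have bS := weighted_sum_bound bB.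
have [h' h'E] := weighted_derivative aS hE.
have [g' g'E] := weighted_derivative bS gE.
pose P z := (1 - z ^+ 2) * h' z; pose Q z := (1 - z ^+ 2) * g' z.
have PQ z : unit_disk z -> normc (Q z) < complex.Re (P z).
  move=> zD; have [_ hp] := h'E z zD; have [_ gq] := g'E z zD.
  exact: (weighted_dominated a1 b1_lt1 zD ab hp gq).
have f_exp z : unit_disk z -> has_wirtinger f z (h' z) (conjc (g' z)).
  move=> zD; have [hz _] := h'E z zD; have [gz _] := g'E z zD.
  have := has_wirtingerD hz (has_wirtinger_conj gz); rewrite add0r conjc0 addr0.
  apply: near_has_wirtinger; have := open_nbhs_nbhs (conj (@open_unit_disk R) zD).
  by apply: (@filterS _ (nbhs z) (nbhs_filter z)) => w wD; rewrite fE.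
have f_cont z : unit_disk z -> {for z, continuous f}.
  by move=> /f_exp; exact: has_wirtinger_continuous.
have f_vel (u v du dv t : R) : in_strip (v + t * dv) ->
  velocity (fun s => f (strip_map (u + s * du) (v + s * dv))) t
   ((du +i* dv) * P (strip_map (u + t * du) (v + t * dv)) +
    conjc ((du +i* dv) * Q (strip_map (u + t * du) (v + t * dv)))).
  move=> vt; have TD := strip_map_disk (u + t * du) vt.
  have := velocity_comp (c := fun s => strip_map (u + s * du) (v + s * dv))
    (f_exp _ TD) (strip_map_velocity u du vt).
  by congr velocity; rewrite /P /Q !conjcM; ring.
have W_unif (e : R) : 0 < e -> exists2 r : R, 0 < r &
    forall z w, unit_disk z -> unit_disk w ->
    normc (z - w) < r -> normc ((P z + Q z) - (P w + Q w)) <= e.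
  move=> e0; have e2 : 0 < e / 2 by rewrite divr_gt0.
  have [r1 r10 h1] := power_series_unif_continuous aS (fun z zD => (h'E z zD).2) e2.
  have [r2 r20 h2] := power_series_unif_continuous bS (fun z zD => (g'E z zD).2) e2.
  exists (Num.min r1 r2) => [|z w zD wD]; first by rewrite lt_min r10.
  rewrite lt_min => /andP[zw1 zw2].
  rewrite opprD addrACA (le_trans (ler_normcD _ _))// (splitr e) lerD//.
    exact: h1.
  exact: h2.
split.
- split=> // z zD; have [-> ->] := has_wirtinger_f_z (f_exp z zD).
  by have := PQ z zD; rewrite /Q !Normc.normcM normc_conj.
- exact: (f2_convex_in_vertical_direction f_vel PQ f_cont W_unif).
- exact: (f2_close_to_convex f_vel PQ f_cont W_unif).
Qed.
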